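(* For every $\varepsilon>0$ there exists a constant $C(\varepsilon)>0$, depending only on $\varepsilon$, such that for every prime $q$ and every integer $a$, $$N(q,a)\le C(\varepsilon)\, q^{2+\varepsilon},$$ where $N(q,a)$ denotes the smallest positive integer $n$ for which $\phi(n)\equiv a \pmod q$.
   Context: Here $\phi$ denotes Euler's totient function. For a prime $q$ and an integer $a$, $N(q,a)$ is the smallest positive integer $n$ with $\phi(n)\equiv a\pmod q$; such an $n$ always exists. *)

(* Defs.v *)
From mathcomp Require Import all_boot all_order all_algebra.

Set Implicit Arguments.
Unset Strict Implicit.
Unset Printing Implicit Defensive.

(* [is_least_totient_preimage q a n] says that n = N(q, a).  It is a relation
   rather than a function of (q, a) so that no default value is needed where no
   such n exists; at most one n satisfies it. *)
Definition is_least_totient_preimage (q : nat) (a : int) (n : nat) : Prop :=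
  [/\ 0 < n,
      (Posz (totient n) = a %[mod Posz q])%Z
    & forall m : nat, 0 < m -> (Posz (totient m) = a %[mod Posz q])%Z -> n <= m].

(* Main.v *)
Require Import Defs.
From mathcomp Require Import all_boot all_order all_algebra.
From mathcomp Require Import all_classical all_reals all_analysis.
From mathcomp Require Import cyclic separable cyclotomic finfield complex.
From mathcomp Require Import zify ring lra.
Import Order.TTheory GRing.Theory Num.Theory.

(** The preimage is sought as a product [l * l' * p] of three distinct primes,
    with [l] and [l'] at most [x], a little larger than [q], and [p] at most
    [z], about [q ^ (1 / k)]; then [phi] takes the value
    [(l - 1) * (l' - 1) * (p - 1)].  Weighting by [ln l * ln l'] and detecting
    the congruence with the multiplicative characters [chi] modulo [q], the
    number of such triples is
      [1 / (q - 1) * \sum_chi conj (chi a) * S chi ^ 2 * t chi],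
    where [S chi = \sum_l ln l * chi (l - 1)] and
    [t chi = \sum_p chi (p - 1)].  The principal character gives the main term,
    bounded below through Chebyshev's estimate [primes_lower].  For the others all
    losses are measured by one parameter [T], which bounds both the divisor
    function on [1 .. x] and the binary logarithm of [8 x], and can be taken as
    a power of [q] with an arbitrarily small exponent.  Three facts are used.
    - In mean square over the characters, [S] has the size of a square root
      ([large_prime_mean_square]).
    - For all but very few characters, [t] is smaller than trivial by a factor
      of order [T ^ 4]: its [2k]-th moment counts coincidences between products
      of [k] numbers [p - 1], all below [q], hence coincidences of integers, and
      the divisor bound [tau_bound] makes them rare ([small_prime_moment]).
    - For each of the remaining characters, [S] itself is smaller than trivial
      by a higher power of [T] ([prime_char_sum]).
    The inequality [le_threshold_power] combines the three without listing the
    exceptional characters ([weighted_triples_lower]).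

    The individual bound on [S] rests on Vaughan's identity ([vaughan]), which
    leaves linear sums [\sum_m chi (b m - 1)] and bilinear sums
    [\sum_c \sum_m alpha_c beta_m chi (c m - 1)].  Since [x] exceeds [q] by a
    high power of [T], both are elementary.  The linear sums run over
    complete periods up to an error [q] ([complete_sum_le]).  In the bilinear
    sums the variable [c] is completed modulo [q], and the correlations
    [\sum_r chi (r d - 1) * conj (chi (r d' - 1))] that appear are bounded by
    a linear fractional substitution ([mult_char_correlation]).  The condition
    [c m <= x], which ties the two variables together, is removed by
    the dyadic argument of Rademacher and Menshov ([rademacher_menshov]).

    The saving [u] is a fixed power of [T], and [x = q * u ^ 6].

    The argument applies to large [q].  For the finitely many others it is
    enough to have some preimage, bounded in terms of [q]: if all prime factors of
    [m] divide [A], then [phi (m A) = m phi A], and [A = (q - 1)!] allows every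
    [m < q] ([small_modulus]).  The class of [0] contains [phi (q ^ 2)]. *)

Set Implicit Arguments.
Unset Strict Implicit.
Unset Printing Implicit Defensive.

(** * Divisors, primes and the totient *)

Lemma expn_mono m n e : m <= n -> m ^ e <= n ^ e.
Proof. by case: e => [//|e] h; rewrite leq_exp2r. Qed.

Definition tau n := size (divisors n).

(** Obtained from [a / J < 2 ^ (a / J)] by raising to the power [J]. *)
Lemma succ_exp_le J a : 0 < J -> a.+1 ^ J <= J ^ J * 2 ^ a.
Proof.
move=> J0; have h1 : a.+1 <= J * 2 ^ (a %/ J).
  apply: (@leq_trans (J * (a %/ J).+1)).
    by rewrite mulnC ltn_ceil.
  by rewrite leq_mul2l ltn_expl ?orbT.
apply: (leq_trans (expn_mono J h1)).
by rewrite expnMn leq_mul2l -expnM leq_exp2l // leq_divM orbT.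
Qed.

Lemma tau_mul m n : 0 < m -> 0 < n -> tau (m * n) <= tau m * tau n.
Proof.
move=> m0 n0; rewrite /tau -(size_allpairs muln).
apply: uniq_leq_size; first exact: divisors_uniq.
move=> d; rewrite -dvdn_divisors ?muln_gt0 ?m0 // => dmn.
have d0 : 0 < d by apply: dvdn_gt0 dmn; rewrite muln_gt0 m0.
have g0 : 0 < gcdn d m by rewrite gcdn_gt0 d0.
apply/allpairsP; exists (gcdn d m, d %/ gcdn d m) => /=; split.
- by rewrite -dvdn_divisors // dvdn_gcdr.
- rewrite -dvdn_divisors //.
  have cop : coprime (d %/ gcdn d m) (m %/ gcdn d m).
    by rewrite /coprime -(eqn_pmul2r g0) muln_gcdl !divnK ?dvdn_gcdl ?dvdn_gcdr // mul1n.
  rewrite -(Gauss_dvdr _ cop) -(dvdn_pmul2r g0) divnK ?dvdn_gcdl //.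
  by rewrite mulnAC divnK ?dvdn_gcdr.
- by rewrite mulnC divnK ?dvdn_gcdl.
Qed.

Lemma tau_pfactor p a : prime p -> tau (p ^ a) <= a.+1.
Proof.
move=> pp; rewrite /tau -[a.+1](size_iota 0) -(size_map (expn p) (iota _ _)).
apply: uniq_leq_size; first exact: divisors_uniq.
move=> d; rewrite -dvdn_divisors ?expn_gt0 ?prime_gt0 // => /(dvdn_pfactor _ _ pp)[i ia ->].
by apply/mapP; exists i; rewrite // mem_iota.
Qed.

(** For primes [p >= 2 ^ J] the bound [(a + 1) ^ J <= p ^ a] holds without any
    constant; each of the at most [2 ^ J] smaller primes costs a factor
    [J ^ J].  The induction is on a bound for the prime factors. *)
Lemma tau_bound J : 0 < J -> exists2 C, 0 < C & forall N, 0 < N -> tau N ^ J <= C * N.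
Proof.
move=> J0; pose D := J ^ J; have D0 : 0 < D by rewrite expn_gt0 J0.
exists (D ^ 2 ^ J); first by rewrite expn_gt0 D0.
have key m : forall N, 0 < N -> (forall p, prime p -> p %| N -> p <= m) ->
  tau N ^ J <= D ^ minn m (2 ^ J) * N.
  elim: m => [|m IH] N N0 Nm.
    suff -> : N = 1 by rewrite /tau /= exp1n min0n.
    apply/eqP; rewrite eqn_leq N0 andbT leqNgt; apply/negP => N1.
    have := Nm _ (pdiv_prime N1) (pdiv_dvd N).
    by rewrite leqNgt prime_gt0 // pdiv_prime.
  set p := m.+1; set a := logn p N; set r := N %/ p ^ a.
  have pa : p ^ a %| N by apply: pfactor_dvdnn.
  have Ner : N = p ^ a * r by rewrite mulnC divnK.
  have p_gt0 : 0 < p ^ a by rewrite expn_gt0.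
  have r0 : 0 < r by move: N0; rewrite Ner muln_gt0 => /andP[].
  have IHr : tau r ^ J <= D ^ minn m (2 ^ J) * r.
    apply: IH => // p' pp' dp'.
    have := Nm _ pp' (dvdn_trans dp' (dvdn_div pa)).
    rewrite leq_eqVlt => /orP[/eqP p'E|//].
    have : p ^ a.+1 %| N by rewrite Ner expnS mulnC; apply: dvdn_mul => //; rewrite /p -p'E.
    by rewrite pfactor_dvdn ?ltnn // /p -p'E.
  have tpa : tau (p ^ a) ^ J <= (if p <= 2 ^ J then D else 1) * p ^ a.
    have [pp|npp] := boolP (prime p); last first.
      by rewrite /a lognE (negbTE npp) /= /tau /= exp1n muln1; case: ifP.
    apply: (leq_trans (expn_mono J (tau_pfactor a pp))).
    case: (leqP p (2 ^ J)) => hp.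
      apply: (leq_trans (succ_exp_le a J0)).
      by rewrite /= leq_mul2l expn_mono ?prime_gt1 ?orbT.
    rewrite mul1n; apply: (@leq_trans ((2 ^ a) ^ J)).
      by rewrite expn_mono // ltn_expl.
    by rewrite -expnM mulnC expnM expn_mono // ltnW.
  have tN : tau N ^ J <= tau (p ^ a) ^ J * tau r ^ J.
    by rewrite -expnMn {1}Ner expn_mono // tau_mul.
  apply: (leq_trans tN); apply: (leq_trans (leq_mul tpa IHr)).
  rewrite mulnACA -Ner leq_mul2r; apply/orP; right.
  case: (leqP p (2 ^ J)) => hp; last by rewrite mul1n leq_pexp2l // geq_minr.
  by rewrite -expnS leq_pexp2l // /p ltnS geq_minl.
move=> N N0; apply: (leq_trans (key N N N0 _)).
  by move=> p pp /dvdn_leq; apply.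
by rewrite leq_mul2r leq_pexp2l ?orbT // geq_minr.
Qed.

Lemma exp2_le_central n : 2 ^ n <= 'C(n.*2, n).
Proof.
elim: n => [//|n IH]; rewrite doubleS expnS.
have e : n.+1 * 'C(n.*2.+2, n.+1) = n.*2.+2 * 'C(n.*2.+1, n) by rewrite mul_bin_diag.
have le2 : 'C(n.*2, n) <= 'C(n.*2.+1, n).
  by case: n {IH e} => [//|n]; rewrite [X in _ <= X]binS leq_addr.
rewrite -(leq_pmul2l (ltn0Sn n)) e.
have -> : n.*2.+2 = n.+1 * 2 by rewrite -doubleS -muln2.
by rewrite -mulnA leq_mul2l leq_mul2l (leq_trans IH le2) orbT.
Qed.

(** In Legendre's formula each power of [p] up to [2n] contributes at most
    [1] to the exponent of [p] in the central binomial coefficient. *)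
Lemma logn_central p n : prime p -> 0 < n -> p ^ logn p 'C(n.*2, n) <= n.*2.
Proof.
move=> pp n0; have nn : 0 < n.*2 by rewrite double_gt0.
apply: (leq_trans _ (trunc_logP (prime_gt1 pp) nn)).
rewrite leq_exp2l ?prime_gt1 //; set t := trunc_log p n.*2.
have le : n <= n.*2 by rewrite -addnn leq_addr.
have := bin_fact le; rewrite -{2}addnn addnK => /(congr1 (logn p)).
rewrite !lognM ?muln_gt0 ?fact_gt0 ?bin_gt0 // !logn_fact // => e.
have ext : \sum_(1 <= k < n.+1) n %/ p ^ k = \sum_(1 <= k < n.*2.+1) n %/ p ^ k.
  rewrite [RHS](big_cat_nat (n := n.+1)) ?ltnS //= [X in _ = _ + X]big1_seq ?addn0 // => k /andP[_].
  rewrite mem_index_iota => /andP[nk _]; apply: divn_small.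
  apply: (leq_trans nk); apply: ltnW; apply: ltn_expl; exact: prime_gt1.
rewrite ext in e.
have le1 : \sum_(1 <= k < n.*2.+1) n.*2 %/ p ^ k <=
   \sum_(1 <= k < n.*2.+1) (n %/ p ^ k + n %/ p ^ k) + \sum_(1 <= k < n.*2.+1) (k <= t).
  rewrite -big_split /=; apply: leq_sum => k _.
  have pk0 : 0 < p ^ k by rewrite expn_gt0 prime_gt0.
  have [kt|tk] := leqP k t.
    rewrite -addnn; have := divn_eq n (p ^ k); have := ltn_pmod n pk0.
    set u := n %/ _; set v := _ %% _ => hv hn.
    rewrite -ltnS ltn_divLR //; rewrite hn; lia.
  rewrite divn_small //; apply: contraLR tk; rewrite -!leqNgt => h.
  by apply: trunc_log_max => //; apply: prime_gt1.
have le2 : \sum_(1 <= k < n.*2.+1) (k <= t) <= t.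
  rewrite -big_mkcond sum1_count.
  have -> : count (fun k => k <= t) (index_iota 1 n.*2.+1) =
    size [seq k <- index_iota 1 n.*2.+1 | k <= t] by rewrite size_filter.
  rewrite -[X in _ <= X](size_iota 1); apply: uniq_leq_size.
    by rewrite filter_uniq // iota_uniq.
  move=> k; rewrite mem_filter mem_index_iota mem_iota; lia.
rewrite big_split /= in le1; lia.
Qed.

Lemma prime_dvd_fact p n : prime p -> p %| n`! -> p <= n.
Proof.
move=> pp; elim: n => [|n IH]; first by rewrite dvdn1 => /eqP p1; rewrite p1 in pp.
rewrite factS Euclid_dvdM // => /orP[/dvdn_leq->//|/IH]; lia.
Qed.

(** Chebyshev's lower bound: the central binomial coefficient is at least
    [2 ^ n], and it is a product of prime powers each at most [2n]. *)
Lemma primes_lower n l : 0 < n -> n.*2 <= 2 ^ l ->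
  n <= l * \sum_(0 <= p < n.*2.+1 | prime p) 1.
Proof.
move=> n0 nl; set P := \sum_(_ <= _ < _ | _) _.
rewrite -(leq_exp2l (m := 2)) // expnM.
apply: (leq_trans (exp2_le_central n)).
set c := 'C(_, _); have c0 : 0 < c by rewrite bin_gt0 -addnn leq_addr.
have -> : c = \prod_(p <- primes c) p ^ logn p c.
  by rewrite {1}(prod_prime_decomp c0) prime_decompE big_map.
apply: (@leq_trans ((2 ^ l) ^ size (primes c))).
  elim: (primes c) (all_prime_primes c) => [|p s IH] /=; first by rewrite big_nil.
  move=> /andP[pp /IH h]; rewrite big_cons expnS leq_mul //.
  by apply: leq_trans nl; apply: logn_central.
rewrite leq_pexp2l ?expn_gt0 // /P sum1_count -size_filter.
apply: uniq_leq_size; first exact: primes_uniq.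
move=> p; rewrite mem_primes mem_filter mem_index_iota => /and3P[pp _ pc]; rewrite pp /=.
apply: (prime_dvd_fact pp); apply: dvdn_trans pc _.
by rewrite -(bin_fact (m := n)) ?dvdn_mulr // -addnn leq_addr.
Qed.

(** Replaces the real root [N ^ (1 / J)], so that the sizes can be compared with
    integers only. *)
Lemma approximate_root (J N : nat) : 0 < J -> 0 < N -> exists2 T, 0 < T & N <= T ^ J <= 2 ^ J * N.
Proof.
move=> J0 N0; have ex : exists T, N <= T ^ J.
  by exists N; rewrite -[X in X <= _]expn1 leq_pexp2l.
have [T NT Tmin] := ex_minnP ex.
have T0 : 0 < T by rewrite lt0n; apply/eqP => T0; move: NT; rewrite T0 exp0n // leqNgt N0.
exists T => //; rewrite NT /=; have [T1|T2] := leqP T 1.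
  have -> : T = 1 by lia.
  by rewrite exp1n muln_gt0 expn_gt0.
have h : T.-1 ^ J < N.
  by rewrite ltnNge; apply/negP => /Tmin; lia.
apply: (@leq_trans ((2 * T.-1) ^ J)); first by apply: expn_mono; lia.
by rewrite expnMn leq_mul2l ltnW // orbT.
Qed.

Lemma root_below (k q : nat) : 0 < k -> 2 ^ k < q ->
  exists z, [/\ 2 <= z, z ^ k < q & q <= (2 * z) ^ k].
Proof.
move=> k0 kq; have ex : exists m, q <= m ^ k.
  by exists q; rewrite -[X in X <= _]expn1 leq_pexp2l //; lia.
have [m qm mmin] := ex_minnP ex.
have m2 : 2 < m.
  by rewrite ltnNge; apply/negP => h; have := leq_trans qm (expn_mono k h); lia.
exists m.-1; split; first by lia.
  by rewrite ltnNge; apply/negP => /mmin; lia.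
by apply: leq_trans qm (expn_mono k _); lia.
Qed.

Lemma totient_prime_mul p R : prime p -> 0 < R -> p %| R -> totient (p * R) = p * totient R.
Proof.
move=> pp R0 pR; set a := logn p R; set r := R %/ p ^ a.
have pa : p ^ a %| R by apply: pfactor_dvdnn.
have Re : R = p ^ a * r by rewrite mulnC divnK.
have a0 : 0 < a by rewrite logn_gt0 mem_primes pp R0.
have cop : coprime p r.
  rewrite prime_coprime //; apply/negP => h.
  have : p ^ a.+1 %| R by rewrite Re expnS mulnC dvdn_mul.
  by rewrite pfactor_dvdn // ltnn.
have cp k : coprime (p ^ k) r by case: k => [|k]; rewrite ?coprime1n // coprime_pexpl.
rewrite Re mulnA -expnS !totient_coprime // !totient_pfactor //= -[a]prednK //=.
by rewrite expnS; lia.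
Qed.

Lemma totient_mul_supp m R : 0 < m -> 0 < R -> (forall p, prime p -> p %| m -> p %| R) ->
  totient (m * R) = m * totient R.
Proof.
elim/ltn_ind: m => m IH m0 R0 h.
have [m1|m1] := leqP m 1.
  by have -> : m = 1 by [lia]; rewrite !mul1n.
have pp := pdiv_prime m1; set p := pdiv m in pp.
have mE : m = p * (m %/ p) by rewrite mulnC divnK // pdiv_dvd.
have m'0 : 0 < m %/ p by move: m0; rewrite {1}mE muln_gt0 => /andP[].
rewrite mE -mulnA totient_prime_mul //.
- rewrite IH // ?mulnA ?ltn_Pdiv ?prime_gt1 // => p' pp' hp'; apply: h => //.
  by apply: dvdn_trans hp' _; rewrite {2}mE dvdn_mull.
- by rewrite muln_gt0 m'0.
by apply: dvdn_mull; apply: h => //; apply: pdiv_dvd.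
Qed.

Lemma totient_three_primes l l' p : prime l -> prime l' -> prime p ->
  l != l' -> l != p -> l' != p -> totient (l * l' * p) = l.-1 * l'.-1 * p.-1.
Proof.
move=> pl pl' pp n1 n2 n3.
have cop a b : prime a -> prime b -> a != b -> coprime a b.
  by move=> pa pb ab; rewrite prime_coprime // dvdn_prime2.
by rewrite !totient_coprime ?coprimeMl ?cop // !totient_prime.
Qed.

(** The number [(q - 1)!] has all prime factors below [q], so its totient [A] is
    invertible modulo [q], and multiplying by [m < q] multiplies the totient
    by [m]; it remains to solve [m A = r] modulo [q]. *)
Lemma small_modulus (q r : nat) : prime q -> 0 < r < q ->
  exists n, [/\ 0 < n, n <= q`! & totient n = r %[mod q]].
Proof.
move=> qp /andP[r0 rq]; have q0 := prime_gt0 qp.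
have cop : coprime q (totient (q.-1)`!).
  rewrite prime_coprime //; apply/negP => qd.
  (* Each prime factor p of m contributes to its totient only p and p - 1. *)
  have key m : 0 < m -> (forall p, prime p -> p %| m -> p < q) -> ~~ (q %| totient m).
    elim/ltn_ind: m => m IH m0 hm; have [m1|m1] := leqP m 1.
      by have -> : m = 1 by [lia]; rewrite dvdn1; have := prime_gt1 qp; lia.
    have pp := pdiv_prime m1; set p := pdiv m in pp.
    have pq : p < q by apply: hm => //; apply: pdiv_dvd.
    have mE : m = p * (m %/ p) by rewrite mulnC divnK // pdiv_dvd.
    have m'0 : 0 < m %/ p by move: m0; rewrite {1}mE muln_gt0 => /andP[].
    have IHm' : ~~ (q %| totient (m %/ p)).
      apply: IH => //; first by rewrite ltn_Pdiv // prime_gt1.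
      by move=> p' pp' dp'; apply: hm => //; rewrite mE dvdn_mull.
    have [d|nd] := boolP (p %| m %/ p).
      by rewrite mE totient_prime_mul // Euclid_dvdM // negb_or IHm' gtnNdvd ?prime_gt0.
    rewrite mE totient_coprime ?prime_coprime // totient_prime // Euclid_dvdM // negb_or IHm' andbT.
    by rewrite gtnNdvd //; have := prime_gt1 pp; lia.
  move: qd; apply/negP; apply: key; first exact: fact_gt0.
  by move=> p pp /(prime_dvd_fact pp); lia.
set A := totient _ in cop.
have A0 : 0 < A by rewrite totient_gt0 fact_gt0.
have [m [mq m0 mE]] : exists m, [/\ m < q, 0 < m & m * A = r %[mod q]].
  have [v vE] : exists v, v * A = 1 %[mod q].
    case: (egcdnP q A0) => a b e _; exists a; rewrite e gcdnC (eqP cop).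
    by rewrite modnMDl.
  have e : (v * r %% q) * A = r %[mod q].
    by rewrite modnMml -mulnA [r * A]mulnC mulnA -modnMml vE modnMml mul1n.
  exists (v * r %% q); split=> //; first by rewrite ltn_mod.
  rewrite lt0n; apply/eqP => h; move: e; rewrite h mul0n mod0n modn_small //; lia.
exists (m * (q.-1)`!); split.
- by rewrite muln_gt0 m0 fact_gt0.
- have -> : q`! = q * (q.-1)`! by rewrite -{1}(prednK q0) factS prednK.
  by rewrite leq_mul2r (ltnW mq) orbT.
rewrite totient_mul_supp ?fact_gt0 // => p pp pm.
rewrite dvdn_fact // prime_gt0 //=; have := dvdn_leq m0 pm; lia.
Qed.

Local Open Scope ring_scope.

(** * Vaughan's identity *)

(** Letting the index run over the whole range, with the summand vanishing
    beyond [x], avoids the truncation at [x / b] in all manipulations of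
    divisor sums. *)
Lemma sum_multiples (V : nmodType) (b x : nat) (G : nat -> V) :
  (0 < b)%N -> (forall n, (x < n)%N -> G n = 0) ->
  \sum_(1 <= d < x.+1) G (b * d)%N = \sum_(1 <= m < x.+1 | (b %| m)%N) G m.
Proof.
move=> b0 Gx.
transitivity (\sum_(1 <= d < x.+1) \sum_(1 <= m < x.+1 | m == (b * d)%N) G m).
  apply: eq_big_nat => d /andP[d1 dx]; rewrite big_nat1_eq; case: ifPn => //.
  by rewrite muln_gt0 b0 d1 /= -leqNgt => h; rewrite Gx.
rewrite (exchange_big_dep_nat (fun m => (b %| m)%N)) //=; last first.
  by move=> d m _ _ _ /eqP->; apply: dvdn_mulr.
apply: congr_big_nat => // m /andP[bm /andP[m1 mx]].
rewrite -[RHS](_ : \sum_(1 <= d < x.+1 | d == (m %/ b)%N) G m = _); last first.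
  rewrite big_nat1_eq ifT // divn_gt0 // dvdn_leq //=.
  by rewrite ltnS (leq_trans (leq_div _ _)).
apply: eq_bigl => d; rewrite -{1}(divnK bm) mulnC eqn_pmul2l //; exact: eq_sym.
Qed.

Definition moebius (n : nat) : int :=
  if all (fun p => logn p n == 1%N) (primes n) then (-1) ^+ size (primes n) else 0.

Lemma norm_moebius n : `|moebius n| <= 1.
Proof. by rewrite /moebius; case: ifP => _; rewrite ?normr0 // normrX normrN1 expr1n. Qed.

Lemma primes_mul_coprime p e : prime p -> (0 < e)%N -> ~~ (p %| e)%N ->
  perm_eq (primes (p * e)%N) (p :: primes e).
Proof.
move=> pp e0 pe; apply: uniq_perm.
- exact: primes_uniq.
- by rewrite /= primes_uniq mem_primes pp e0 (negbTE pe).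
by move=> r; rewrite primesM ?(prime_gt0 pp) // (primes_prime pp) !inE.
Qed.

Lemma moebius_prime_mul p e : prime p -> (0 < e)%N ->
  moebius (p * e)%N = if (p %| e)%N then 0 else - moebius e.
Proof.
move=> pp e0; have p0 := prime_gt0 pp; case: ifPn => pe.
  rewrite /moebius ifF //; apply/negP => /allP /(_ p).
  rewrite mem_primes pp muln_gt0 p0 e0 dvdn_mulr // => /(_ isT).
  rewrite lognM // logn_prime // eqxx.
  have : (0 < logn p e)%N by rewrite logn_gt0 mem_primes pp e0.
  by case: logn.
have pr := primes_mul_coprime pp e0 pe.
rewrite /moebius (perm_size pr) (perm_all _ pr) /= lognM // logn_prime // eqxx.
rewrite (_ : logn p e = 0%N) ?addn0 ?eqxx /=; last first.
  by apply/eqP; rewrite -leqn0 leqNgt logn_gt0 mem_primes pp e0 (negbTE pe).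
have -> : all (fun p0 => logn p0 (p * e)%N == 1%N) (primes e) =
          all (fun p0 => logn p0 e == 1%N) (primes e).
  apply: eq_in_all => r; rewrite mem_primes => /and3P[pr' _ re].
  rewrite lognM // logn_prime // (_ : (r == p) = false) //.
  by apply/eqP => rp; rewrite -rp re in pe.
by case: ifP; rewrite ?oppr0 // exprS mulN1r.
Qed.

(** The divisors of [n] that are divisible by a prime [p] of [n] cancel the
    others through [moebius (p e) = - moebius e]. *)
Lemma sum_moebius n x : (0 < n <= x)%N ->
  \sum_(1 <= d < x.+1 | (d %| n)%N) moebius d = (n == 1%N)%:R.
Proof.
move=> /andP[n0 nx]; have [n1|n1] := leqP n 1.
  have -> : n = 1%N by lia.
  rewrite (eq_bigl (fun d => d == 1%N)); last by move=> d; rewrite dvdn1.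
  by rewrite big_nat1_eq ifT //= ltnS; lia.
rewrite (_ : (n == 1%N) = false) /=; last by lia.
have pp := pdiv_prime n1; have pn := pdiv_dvd n; set p := pdiv n in pp pn.
pose G d := if (d %| n)%N && (0 < d)%N then moebius d else 0.
have -> : \sum_(1 <= d < x.+1 | (d %| n)%N) moebius d = \sum_(1 <= d < x.+1) G d.
  by rewrite big_mkcond; apply: eq_big_nat => d /andP[d0 _]; rewrite /G d0 andbT.
rewrite (bigID (fun d => (p %| d)%N)) /= -sum_multiples ?prime_gt0 //; last first.
  move=> d xd; rewrite /G ifF //; apply/negP => /andP[/dvdn_leq dn _].
  have := dn n0; lia.
rewrite [X in _ + X]big_mkcond -big_split /= big1_seq // => e /andP[_].
rewrite mem_index_iota => /andP[e0 _].
rewrite /G moebius_prime_mul // muln_gt0 prime_gt0 // e0 !andbT.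
have [pe|pe] := boolP (p %| e)%N; first by rewrite if_same addr0.
rewrite Gauss_dvd ?prime_coprime // pn /=.
by case: ifP => _; rewrite ?addr0 // addNr.
Qed.

Section VonMangoldt.
Variable R : realType.

Definition vonMangoldt (n : nat) : R := if primes n is [:: p] then ln p%:R else 0.

Lemma vonMangoldt_pexp p a : prime p -> (0 < a)%N -> vonMangoldt (p ^ a)%N = ln p%:R.
Proof. by move=> pp a0; rewrite /vonMangoldt primesX // primes_prime. Qed.

Lemma vonMangoldt_prime p : prime p -> vonMangoldt p = ln p%:R.
Proof. by move=> pp; rewrite /vonMangoldt primes_prime. Qed.

Lemma vonMangoldt_neq0 n : vonMangoldt n != 0 ->
  exists p a, [/\ prime p, (0 < a)%N & n = (p ^ a)%N].
Proof.
rewrite /vonMangoldt; case E : (primes n) => [|p [|]]; rewrite ?eqxx // => _.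
have : p \in primes n by rewrite E inE.
rewrite mem_primes => /and3P[pp n0 pn].
exists p, (logn p n); split => //; first by rewrite logn_gt0 E inE.
by rewrite {1}(prod_prime_decomp n0) prime_decompE big_map E big_seq1.
Qed.

Lemma vonMangoldt_ge0 n : 0 <= vonMangoldt n.
Proof.
rewrite /vonMangoldt; case E : (primes n) => [|p [|]] //.
have : p \in primes n by rewrite E inE.
by rewrite mem_primes => /and3P[pp _ _]; rewrite ln_ge0 // ler1n prime_gt0.
Qed.

Lemma vonMangoldt_le n : (0 < n)%N -> vonMangoldt n <= ln n%:R.
Proof.
move=> n0; have := vonMangoldt_neq0; move/(_ n).
have [->|nz /(_ isT)[p [a [pp a0 ne]]]] := eqVneq (vonMangoldt n) 0.
  by rewrite ln_ge0 // ler1n.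
rewrite {1}ne vonMangoldt_pexp // ler_ln ?posrE ?ltr0n ?(prime_gt0 pp) //.
by rewrite ler_nat ne -{1}(expn1 p) leq_exp2l ?prime_gt1.
Qed.

(** Passing from [m] to [p m] adds exactly one prime power to the divisors,
    namely the first power of [p] that does not divide [m]. *)
Lemma sum_vonMangoldt n x : (0 < n <= x)%N ->
  \sum_(1 <= d < x.+1 | (d %| n)%N) vonMangoldt d = ln n%:R.
Proof.
elim/ltn_ind: n => n IH /andP[n0 nx]; have [n1|n1] := leqP n 1.
  have -> : n = 1%N by lia.
  rewrite (eq_bigl (fun d => d == 1%N)); last by move=> d; rewrite dvdn1.
  by rewrite big_nat1_eq ln1 ifT //= ltnS; lia.
have pp := pdiv_prime n1; have pn := pdiv_dvd n; set p := pdiv n in pp pn.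
have p1 := prime_gt1 pp; have p0 := prime_gt0 pp.
set m := (n %/ p)%N; have nE : n = (p * m)%N by rewrite mulnC divnK.
have m0 : (0 < m)%N by move: n0; rewrite nE muln_gt0 => /andP[].
have mn : (m < n)%N by rewrite ltn_Pdiv.
clearbody m.
rewrite (bigID (fun d => (d %| m)%N)) /=.
rewrite (eq_bigl (fun d => (d %| m)%N)); last first.
  by move=> d; case: (boolP (d %| m)%N) => dm; rewrite ?andbF // nE dvdn_mull.
rewrite IH ?m0 //=; last by apply: leq_trans nx; apply: ltnW.
have -> : ln n%:R = ln p%:R + ln m%:R :> R by rewrite nE natrM lnM ?posrE ?ltr0n.
rewrite addrC; congr (_ + _).
set v := logn p m.
have pv : ((p ^ v.+1) %| n)%N by rewrite nE pfactor_dvdn ?muln_gt0 ?p0 // lognM // logn_prime // eqxx.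
transitivity (\sum_(1 <= d < x.+1 | d == (p ^ v.+1)%N) ln p%:R : R); last first.
  by rewrite big_nat1_eq ifT // expn_gt0 p0 /= ltnS (leq_trans _ nx) // dvdn_leq.
rewrite [LHS]big_mkcond [RHS]big_mkcond; apply: eq_big_nat => d /andP[d0 dx].
case: (eqVneq d (p ^ v.+1)%N) => [->|ne].
  by rewrite pv /= pfactor_dvdn // -/v ltnn /= vonMangoldt_pexp.
case: ifP => // /andP[dn dm]; apply/eqP; apply: contraTT dm => nz.
rewrite negbK; have [r [a [pr a0 de]]] := vonMangoldt_neq0 nz.
rewrite de pfactor_dvdn //; move: dn; rewrite de pfactor_dvdn // nE lognM //.
rewrite (logn_prime r pp); have [rp|//] := eqVneq r p.
rewrite rp -/v leq_eqVlt => /orP[/eqP h|]; last by rewrite add1n ltnS.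
by move: ne; rewrite de rp h add1n eqxx.
Qed.

End VonMangoldt.

Section Vaughan.
Variable K : comNzRingType.

(** For [0 < U] it is [1] at [m = 1] and [0] for [1 < m <= U], by Moebius
    inversion: this vanishing is what makes Vaughan's identity useful. *)
Definition moebius_trunc (U m : nat) : K :=
  \sum_(1 <= b < U.+1 | (b %| m)%N) (moebius b)%:~R.

(** Vaughan's identity, summed against [G].  The convolution of [L] with the
    truncated Moebius function equals that of [Lam] with [moebius_trunc U];
    the term [m = 1] gives back the sum of [Lam c * G c], the terms
    [1 < m <= U] vanish, and among those with [m > U] the part [c <= V] is
    turned back into linear sums. *)
Lemma vaughan (Lam L G : nat -> K) (x U V : nat) :
  (forall k, (0 < k <= x)%N -> \sum_(1 <= c < x.+1 | (c %| k)%N) Lam c = L k) ->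
  (0 < U <= x)%N -> (V <= x)%N -> (forall n, (x < n)%N -> G n = 0) ->
  \sum_(1 <= c < x.+1) Lam c * G c =
    \sum_(1 <= b < U.+1) (moebius b)%:~R * (\sum_(1 <= k < x.+1) L k * G (b * k)%N)
  - \sum_(1 <= c < V.+1) Lam c * \sum_(1 <= b < U.+1) (moebius b)%:~R *
       \sum_(1 <= d < x.+1) G (c * (b * d))%N
  + \sum_(1 <= c < V.+1) Lam c * G c
  - \sum_(V.+1 <= c < x.+1) Lam c *
       \sum_(U.+1 <= m < x.+1) moebius_trunc U m * G (c * m)%N.
Proof.
move=> LamL /andP[U0 Ux] Vx Gx.
have H1 (H : nat -> K) : (forall n, (x < n)%N -> H n = 0) ->
    \sum_(1 <= k < x.+1) L k * H k =
    \sum_(1 <= c < x.+1) Lam c * \sum_(1 <= d < x.+1) H (c * d)%N.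
  move=> Hx; transitivity (\sum_(1 <= k < x.+1) \sum_(1 <= c < x.+1 | (c %| k)%N) Lam c * H k).
    apply: eq_big_nat => k kx; rewrite -mulr_suml LamL //.
  rewrite (exchange_big_dep_nat xpredT) //=; apply: eq_big_nat => c /andP[c0 _].
  by rewrite -mulr_sumr sum_multiples.
have H2 (H : nat -> K) : (forall n, (x < n)%N -> H n = 0) ->
    \sum_(1 <= b < U.+1) (moebius b)%:~R * \sum_(1 <= d < x.+1) H (b * d)%N =
    \sum_(1 <= m < x.+1) moebius_trunc U m * H m.
  move=> Hx.
  transitivity (\sum_(1 <= b < U.+1) \sum_(1 <= m < x.+1 | (b %| m)%N) (moebius b)%:~R * H m).
    by apply: eq_big_nat => b /andP[b0 _]; rewrite -mulr_sumr sum_multiples.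
  rewrite (exchange_big_dep_nat xpredT) //=; apply: eq_big_nat => m _.
  by rewrite -mulr_suml.
pose W c := \sum_(U.+1 <= m < x.+1) moebius_trunc U m * G (c * m)%N.
have Gc c : (0 < c)%N -> forall n, (x < n)%N -> G (c * n)%N = 0.
  by move=> c0 n xn; apply: Gx; apply: leq_trans xn _; rewrite leq_pmull.
have H3 c : (0 < c)%N -> \sum_(1 <= m < x.+1) moebius_trunc U m * G (c * m)%N = G c + W c.
  move=> c0; rewrite (big_cat_nat (n := U.+1)) //= -/(W c); congr (_ + _).
  rewrite big_ltn // [X in _ + X]big1_seq ?addr0; last first.
    move=> m /andP[_]; rewrite mem_index_iota => /andP[m2 mU].
    rewrite /moebius_trunc -(rmorph_sum (intr : {rmorphism int -> K})) /=.
    rewrite sum_moebius; last by lia.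
    by rewrite (_ : (m == 1%N) = false) ?mul0r //; lia.
  rewrite /moebius_trunc -(rmorph_sum (intr : {rmorphism int -> K})) /=.
  by rewrite sum_moebius ?U0 // mul1r muln1.
have T1 : \sum_(1 <= b < U.+1) (moebius b)%:~R * (\sum_(1 <= k < x.+1) L k * G (b * k)%N)
   = \sum_(1 <= c < x.+1) Lam c * (G c + W c).
  transitivity (\sum_(1 <= b < U.+1) \sum_(1 <= c < x.+1) Lam c *
      ((moebius b)%:~R * \sum_(1 <= d < x.+1) G (c * (b * d))%N)).
    apply: eq_big_nat => b /andP[b0 _]; rewrite (H1 (fun k => G (b * k)%N)) ?Gc //; last exact: Gc.
    rewrite mulr_sumr; apply: eq_bigr => c _; rewrite mulrCA; do 2 congr (_ * _).
    by apply: eq_bigr => d _; rewrite mulnCA.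
  rewrite exchange_big_nat /=; apply: eq_big_nat => c /andP[c0 _].
  by rewrite -mulr_sumr (H2 (fun n => G (c * n)%N)) ?H3 //; apply: Gc.
have T2 : \sum_(1 <= c < V.+1) Lam c * (\sum_(1 <= b < U.+1) (moebius b)%:~R *
       \sum_(1 <= d < x.+1) G (c * (b * d))%N) = \sum_(1 <= c < V.+1) Lam c * (G c + W c).
  apply: eq_big_nat => c /andP[c0 _].
  by rewrite (H2 (fun n => G (c * n)%N)) ?H3 //; apply: Gc.
rewrite T1 T2 -/W; under [X in X - _ + _ - _]eq_bigr do rewrite mulrDr.
under [X in _ - X + _ - _]eq_bigr do rewrite mulrDr.
rewrite !big_split /= [X in _ + X - _ + _](big_cat_nat (n := V.+1)) //=.
ring.
Qed.

End Vaughan.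

(** * Multiplicative characters of a finite field *)

Section ComplexNorm.
Variable R : rcfType.
Local Notation C := R[i].
Local Notation N := (@Normc.normc R).
Implicit Types z w : C.

Lemma cnorm_ge0 z : 0 <= N z.
Proof. by case: z => a b; rewrite /Normc.normc sqrtr_ge0. Qed.

Lemma cnormD z w : N (z + w) <= N z + N w. Proof. exact: le_normcD. Qed.

Lemma cnormN z : N (- z) = N z. Proof. exact: normcN. Qed.

Lemma cnormB z w : N (z - w) <= N z + N w.
Proof. by rewrite -(cnormN w) cnormD. Qed.

Lemma cnorm_sum (I : Type) (r : seq I) (P : pred I) (G : I -> C) :
  N (\sum_(i <- r | P i) G i) <= \sum_(i <- r | P i) N (G i).
Proof.
elim/big_rec2: _ => [|i y x _ h]; first by rewrite Normc.normc0.
by apply: le_trans (cnormD _ _) _; rewrite lerD2l.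
Qed.

Lemma cnormR (a : R) : N a%:C%C = `|a|.
Proof. by rewrite /Normc.normc /= expr0n /= addr0 sqrtr_sqr. Qed.

Lemma cnormX z n : N (z ^+ n) = N z ^+ n.
Proof. by elim: n => [|n IH]; rewrite ?expr0 ?Normc.normc1 // !exprS Normc.normcM IH. Qed.

Lemma cnorm_conj z : N (conjc z) = N z.
Proof. by case: z => a b; rewrite /Normc.normc /= sqrrN. Qed.

Lemma cnorm_sqr z : ((N z ^+ 2)%:C)%C = z * conjc z.
Proof. by rewrite -sqr_normc rmorphXn. Qed.

Lemma cnorm_conj_inv z : N z = 1 -> conjc z = z^-1.
Proof.
move=> z1; have z0 : z != 0 by apply/eqP => h; move: z1; rewrite h Normc.normc0 => /eqP; rewrite eq_sym oner_eq0.
by apply: (mulfI z0); rewrite -cnorm_sqr z1 expr1n mulfV.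
Qed.

Lemma cnorm_root1 z n : (0 < n)%N -> z ^+ n = 1 -> N z = 1.
Proof.
move=> n0 zn; have := cnormX z n; rewrite zn Normc.normc1 => /esym/eqP.
by rewrite pexpr_eq1 ?cnorm_ge0 // => /eqP.
Qed.

Lemma primitive_root_complex n : (0 < n)%N -> exists z : C, n.-primitive_root z.
Proof.
pose p : {poly C} := 'X^n - 1; have [r Dp] := closed_field_poly_normal p.
move=> n_gt0; rewrite (monicP _) ?monicXnsubC // scale1r in Dp.
have rn1: all n.-unity_root r by apply/allP=> z; rewrite -root_prod_XsubC -Dp.
have sz_r: (n < (size r).+1)%N.
  by rewrite -(size_prod_XsubC r id) -Dp size_XnsubC.
have [|z _ hz] := hasP (has_prim_root n_gt0 rn1 _ sz_r); last by exists z.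
by rewrite -separable_prod_XsubC -Dp separable_Xn_sub_1 // pnatr_eq0 -lt0n.
Qed.

End ComplexNorm.

Section Characters.
Variables (R : rcfType) (F : finFieldType).
Local Notation C := R[i].
Local Notation N := (@Normc.normc R).

Record mult_char (chi : F -> C) : Prop := MultChar {
  mult_char_zero : chi 0 = 0;
  mult_char_mul : forall x y, chi (x * y) = chi x * chi y;
  mult_char_norm : forall x, x != 0 -> N (chi x) = 1 }.

Section OneChar.
Variable chi : F -> C.
Hypothesis chiP : mult_char chi.

Lemma mult_char_norm_le1 x : N (chi x) <= 1.
Proof.
have [->|x0] := eqVneq x 0; first by rewrite (mult_char_zero chiP) Normc.normc0.
by rewrite (mult_char_norm chiP).
Qed.

Lemma mult_char_neq0 x : x != 0 -> chi x != 0.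
Proof.
move=> /(mult_char_norm chiP) h; apply/eqP => h0; move: h; rewrite h0 Normc.normc0 => /eqP.
by rewrite eq_sym oner_eq0.
Qed.

Lemma mult_char_one : chi 1 = 1.
Proof.
have c0 := mult_char_neq0 (oner_neq0 F); apply: (mulfI c0).
by rewrite -(mult_char_mul chiP) !mulr1.
Qed.

Lemma mult_char_conj x : conjc (chi x) = chi x^-1.
Proof.
have [->|x0] := eqVneq x 0; first by rewrite invr0 (mult_char_zero chiP) conjc0.
rewrite cnorm_conj_inv ?(mult_char_norm chiP) //; apply: (mulfI (mult_char_neq0 x0)).
by rewrite mulfV ?mult_char_neq0 // -(mult_char_mul chiP) mulfV // mult_char_one.
Qed.

(** For nonzero arguments, the translation [r = s + 1 / d'] and the
    substitution of [h / s] for [s] turn the correlation into the sum of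
    [chi (1 + t)] over [t <> 0], that is, into [- chi 1]. *)
Lemma mult_char_correlation (d d' : F) : \sum_x chi x = 0 -> d != d' ->
  N (\sum_r chi (r * d - 1) * conjc (chi (r * d' - 1))) <= 1.
Proof.
move=> sum0.
have lin e : e != 0 -> \sum_r chi (r * e - 1) = 0.
  move=> e0; rewrite -[RHS]sum0 [RHS](reindex_inj (h := fun r => r * e - 1)) //.
  by move=> r s /addIr /(mulIf e0).
have [->|d0] := eqVneq d 0 => [ne|].
  under eq_bigr do rewrite mulr0.
  by rewrite -mulr_sumr -rmorph_sum lin 1?eq_sym // rmorph0 mulr0 Normc.normc0 ler01.
have [->|d'0] := eqVneq d' 0 => [_|ne].
  under eq_bigr do rewrite mulr0.
  by rewrite -mulr_suml lin // mul0r Normc.normc0 ler01.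
set h := d'^-1 - d^-1.
have h0 : h != 0 by rewrite subr_eq0 (inj_eq invr_inj) eq_sym.
have sw e r : e != 0 -> chi (r * e - 1) = chi e * chi (r - e^-1).
  by move=> e0; rewrite -(mult_char_mul chiP) mulrBr mulfV // mulrC.
have -> : \sum_r chi (r * d - 1) * conjc (chi (r * d' - 1)) =
    chi d * conjc (chi d') * \sum_s chi (s + h) * conjc (chi s).
  rewrite mulr_sumr (reindex_inj (addIr d'^-1)) /=; apply: eq_bigr => s _.
  by rewrite !sw // addrK rmorphM /= -addrA -/h mulrACA.
rewrite !Normc.normcM cnorm_conj !(mult_char_norm chiP) // !mul1r.
rewrite (bigD1 0) //= (mult_char_zero chiP) conjc0 mulr0 add0r.
have -> : \sum_(s | s != 0) chi (s + h) * conjc (chi s) = \sum_(s | s != 0) chi (1 + h * s^-1).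
  apply: eq_bigr => s s0; rewrite mult_char_conj -(mult_char_mul chiP) mulrDl mulfV //.
have inj : injective (fun s : F => h * s^-1) by move=> s t /(mulfI h0)/invr_inj.
have -> : \sum_(s | s != 0) chi (1 + h * s^-1) = \sum_(t | t != 0) chi (1 + t).
  rewrite [RHS](reindex_inj inj) /=; apply: eq_bigl => s.
  by rewrite mulf_eq0 invr_eq0 (negbTE h0).
have := sum0; rewrite (reindex_inj (addrI 1)) /= (bigD1 0) //= addr0 mult_char_one addrC => /eqP.
by rewrite addr_eq0 => /eqP ->; rewrite cnormN Normc.normc1.
Qed.

End OneChar.

Let n := #|F|.-1.

Lemma card_pred_gt0 : (0 < n)%N.
Proof. by rewrite /n -subn1 subn_gt0 finRing_gt1. Qed.

Lemma unit_expf x : x != 0 :> F -> x ^+ n = 1.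
Proof.
move=> x0; apply: (mulfI x0); rewrite -exprS /n prednK ?expf_card ?mulr1 //.
by apply: ltnW; apply: finRing_gt1.
Qed.

Lemma primitive_root_finField : exists g : F, n.-primitive_root g.
Proof.
have n0 := card_pred_gt0.
have h1 : all n.-unity_root (enum [pred x : F | x != 0]).
  by apply/allP => x; rewrite mem_enum inE => x0; rewrite unity_rootE unit_expf.
have h2 : (size (enum [pred x : F | x != 0%R]) >= n)%N.
  by rewrite -cardE cardC1.
by have /hasP[g _ gp] := has_prim_root n0 h1 (enum_uniq _) h2; exists g.
Qed.

(** The characters are built by sending a primitive root of the field to the
    powers of a complex primitive root of unity of the same order. *)
Lemma characters_exist : exists X : 'I_n -> F -> C,
  [/\ forall j, mult_char (X j),
      forall j : 'I_n, j != 0%N :> nat -> \sum_x X j x = 0,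
      forall (j : 'I_n) x, j = 0%N :> nat -> x != 0 -> X j x = 1
    & forall x y, x != 0 -> y != 0 ->
        \sum_j X j x * conjc (X j y) = n%:R * (x == y)%:R].
Proof.
have n0 := card_pred_gt0.
have [g gp] := primitive_root_finField.
have [w wp] := primitive_root_complex R n0.
have exlog x : x != 0 -> exists i : 'I_n, x == g ^+ i.
  by move=> x0; have [i ->] := prim_rootP gp (unit_expf x0); exists i.
pose dl (x : F) : nat := if [pick i : 'I_n | x == g ^+ i] is Some i then i else 0%N.
have dlP x : x != 0 -> g ^+ dl x = x.
  move=> x0; rewrite /dl; case: pickP => [i /eqP //|h].
  by have [k] := exlog x x0; rewrite h.
have dlE x k : x != 0 -> x = g ^+ k -> w ^+ k = w ^+ dl x.
  move=> x0 xi; apply/eqP; rewrite (eq_prim_root_expr wp) -(eq_prim_root_expr gp).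
  by rewrite dlP // xi.
have gn0 : g != 0.
  by apply/eqP => h; have := prim_expr_order gp; rewrite h expr0n eqn0Ngt n0 => /eqP; rewrite eq_sym oner_eq0.
have wn k : (w ^+ k) ^+ n = 1 by rewrite exprAC (prim_expr_order wp) expr1n.
have Nw k : N (w ^+ k) = 1 by apply: (cnorm_root1 n0).
pose X (j : 'I_n) x : C := if x == 0 then 0 else (w ^+ dl x) ^+ j.
have XP j : mult_char (X j).
  split.
  - by rewrite /X eqxx.
  - move=> x y; rewrite /X mulf_eq0.
    have [->|x0] := eqVneq x 0; first by rewrite /= !mul0r.
    have [->|y0] := eqVneq y 0; first by rewrite /= !mulr0.
    rewrite -exprMn -exprD -(dlE (x * y) (dl x + dl y)%N) ?mulf_neq0 //.
    by rewrite exprD !dlP.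
  - by move=> x x0; rewrite /X (negbTE x0) -exprM Nw.
exists X; split=> //.
- move=> j j0.
  have Xg : X j g != 1.
    rewrite /X (negbTE gn0) -(dlE g 1%N) // ?expr1 //.
    by rewrite -(prim_order_dvd wp) gtnNdvd // lt0n.
  have e : X j g * \sum_x X j x = \sum_x X j x.
    rewrite mulr_sumr [RHS](reindex_inj (mulfI gn0)) /=.
    by apply: eq_bigr => x _; rewrite (mult_char_mul (XP j)).
  apply/eqP; move/eqP: e; rewrite -subr_eq0 -{2}[\sum_x _]mul1r -mulrBl mulf_eq0 subr_eq0.
  by rewrite (negbTE Xg).
- by move=> j x j0 x0; rewrite /X (negbTE x0) j0 expr0.
move=> x y x0 y0; set z := w ^+ dl x * conjc (w ^+ dl y).
transitivity (\sum_(j < n) z ^+ j).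
  by apply: eq_bigr => j _; rewrite /X (negbTE x0) (negbTE y0) rmorphXn -exprMn.
have wy0 : w ^+ dl y != 0.
  by apply/eqP => h; have := Nw (dl y); rewrite h Normc.normc0 => /eqP; rewrite eq_sym oner_eq0.
have zE : z = w ^+ dl x / w ^+ dl y by rewrite /z cnorm_conj_inv.
have [xy|xy] := eqVneq x y.
  have z1 : z = 1 by rewrite zE xy mulfV.
  by under eq_bigr do rewrite z1 expr1n; rewrite sumr_const card_ord mulr1.
have z1 : z != 1.
  apply: contra xy => /eqP z1; have : w ^+ dl x = w ^+ dl y.
    by apply: (mulIf (invr_neq0 wy0)); rewrite -zE z1 mulfV.
  move/eqP; rewrite (eq_prim_root_expr wp) -(eq_prim_root_expr gp) !dlP //.
have zn : z ^+ n = 1 by rewrite zE exprMn exprVn !wn invr1 mulr1.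
have := subrX1 z n; rewrite zn subrr mulr0 => /esym/eqP.
by rewrite mulf_eq0 subr_eq0 (negbTE z1) => /eqP.
Qed.

End Characters.

(** * Dyadic decomposition and incomplete sums *)

Lemma sum_residues (V : nmodType) (q : nat) (h : 'F_q -> V) (s : nat) : prime q ->
  \sum_(s <= k < s + q) h k%:R = \sum_x h x.
Proof.
move=> qp; rewrite -{1}[s]add0n big_addn addnC addnK big_mkord.
pose e (k : 'I_q) : 'F_q := (k + s)%:R.
have einj : injective e.
  move=> i j /eqP; rewrite /e !natrD (inj_eq (addIr _)) => /eqP/(congr1 val).
  rewrite /= !val_Fp_nat // !modn_small //; exact: val_inj.
have [e' eK e'K] : bijective e by apply: inj_card_bij => //; rewrite card_Fp // card_ord.
by rewrite [RHS](reindex e) //; exists e' => x _; rewrite ?eK ?e'K.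
Qed.

(** A block of length [M] is covered by [M / q + 1] blocks of length [q]. *)
Lemma sum_residues_le (R : realFieldType) (q : nat) (h : 'F_q -> R) (s M : nat) : prime q ->
  (forall x, 0 <= h x) ->
  \sum_(s <= k < s + M) h k%:R <= (M %/ q).+1%:R * \sum_x h x.
Proof.
move=> qp h0; have q0 := prime_gt0 qp.
elim/ltn_ind: M s => M IH s; have [Mq|qM] := ltnP M q.
  rewrite divn_small // mul1r -(sum_residues h s qp).
  rewrite [X in _ <= X](big_cat_nat (n := s + M)) ?leq_addr ?leq_add2l 1?ltnW //=.
  by rewrite lerDl sumr_ge0.
rewrite (big_cat_nat (n := s + q)) ?leq_addr ?leq_add2l //= sum_residues //.
have -> : (s + M = (s + q) + (M - q))%N by lia.
have Me : (M %/ q = ((M - q) %/ q).+1)%N by rewrite -{1}(subnK qM) divnDr // divnn q0 addn1.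
rewrite Me [X in X * _]mulrS mulrDl mul1r lerD2l; apply: IH; lia.
Qed.

Section Sums.
Variable R : realType.
Local Notation C := R[i].
Local Notation N := (@Normc.normc R).

Lemma periodic_sum_le (q : nat) (g : nat -> C) (K : nat) : (0 < q)%N ->
  (forall k, N (g k) <= 1) -> (forall k, g (k + q)%N = g k) ->
  \sum_(0 <= k < q) g k = 0 -> N (\sum_(0 <= k < K) g k) <= q%:R.
Proof.
move=> q0 g1 gq s0; elim/ltn_ind: K => K IH; have [Kq|qK] := ltnP K q.
  apply: le_trans (cnorm_sum _ _ _) _.
  apply: (le_trans (y := \sum_(0 <= k < K) 1)); first by apply: ler_sum.
  by rewrite big_const_nat subn0 iter_addr_0 ler_nat ltnW.
rewrite (big_cat_nat (n := q)) //= s0 add0r -{1}[q]add0n big_addn.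
under eq_bigr do rewrite gq.
apply: IH; lia.
Qed.

Lemma abel_sum_le (a : nat -> R) (g : nat -> C) (B : R) (K : nat) :
  0 <= a 0%N -> (forall k, a k <= a k.+1) ->
  (forall n, N (\sum_(0 <= k < n) g k) <= B) ->
  N (\sum_(0 <= k < K) (a k)%:C%C * g k) <= 2 * a K * B.
Proof.
move=> a0 ainc gB; have B0 : 0 <= B by apply: le_trans (gB 0%N); apply: cnorm_ge0.
have ak k : 0 <= a k by elim: k => // k IH; apply: le_trans IH _.
suff key : N (\sum_(0 <= k < K) (a k)%:C%C * g k - (a K)%:C%C * \sum_(0 <= k < K) g k) <= a K * B.
  rewrite -[X in N X](subrK ((a K)%:C%C * \sum_(0 <= k < K) g k)).
  apply: le_trans (cnormD _ _) _; rewrite Normc.normcM cnormR ger0_norm //.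
  have := gB K; have := ak K => h1 h2.
  have := ler_wpM2l h1 h2; lra.
elim: K => [|K IH].
  by rewrite !big_geq // mulr0 subrr Normc.normc0 mulr_ge0.
have h := gB K.+1; move: h; rewrite !big_nat_recr //= => h.
set A := \sum_(0 <= k < K) _ * _ in IH *; set G := \sum_(0 <= k < K) _ in IH h *.
have -> : A + (a K)%:C%C * g K - (a K.+1)%:C%C * (G + g K) =
  (A - (a K)%:C%C * G) - (a K.+1 - a K)%:C%C * (G + g K) by rewrite rmorphB /=; ring.
apply: le_trans (cnormB _ _) _; rewrite Normc.normcM cnormR ger0_norm ?subr_ge0 //.
have d0 : 0 <= a K.+1 - a K by rewrite subr_ge0.
have := ler_wpM2l d0 h; lra.
Qed.

(** The sum of the squared norms of the sums of [g] over all dyadic intervals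
    contained in {0, ..., 2^L - 1}. *)
Fixpoint dyadic_energy (L : nat) (g : nat -> C) : R :=
  if L is L'.+1 then
    N (\sum_(0 <= k < 2 ^ L) g k) ^+ 2 + dyadic_energy L' g + dyadic_energy L' (fun k => g (2 ^ L' + k)%N)
  else N (g 0%N) ^+ 2.

Lemma dyadic_energy_ge0 L g : 0 <= dyadic_energy L g.
Proof. by elim: L g => [|L IH] g /=; rewrite ?addr_ge0 ?sqr_ge0. Qed.

Lemma dyadic_energy_head L g : N (\sum_(0 <= k < 2 ^ L) g k) ^+ 2 <= dyadic_energy L g.
Proof.
case: L => [|L] /=; first by rewrite expn0 big_nat1.
by rewrite -addrA lerDl addr_ge0 ?dyadic_energy_ge0.
Qed.

(** An initial segment of {0, ..., 2^L - 1} is a disjoint union of dyadic intervals, at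
    most one of each length.  The point of the estimate is that its right-hand
    side does not depend on [n], which may therefore vary with another
    variable. *)
Lemma rademacher_menshov L g n : (n <= 2 ^ L)%N ->
  N (\sum_(0 <= k < n) g k) ^+ 2 <= L.+1%:R * dyadic_energy L g.
Proof.
elim: L g n => [|L IH] g n nL.
  rewrite mul1r /=; case: n nL => [|[|//]] _; last by rewrite big_nat1.
  by rewrite big_geq // Normc.normc0 expr0n sqr_ge0.
have [nl|nl] := leqP n (2 ^ L).
  apply: le_trans (IH g n nl) _.
  apply: ler_pM; rewrite ?ler0n ?dyadic_energy_ge0 ?ler_nat //=.
  by rewrite addrAC lerDr addr_ge0 ?sqr_ge0 ?dyadic_energy_ge0.
rewrite (big_cat_nat (n := (2 ^ L)%N)) ?(ltnW nl) //=.
set A := \sum_(0 <= k < 2 ^ L) g k.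
set n' := (n - 2 ^ L)%N.
have n'L : (n' <= 2 ^ L)%N by rewrite /n' leq_subLR addnn -mul2n -expnS.
have := IH (fun k => g (2 ^ L + k)%N) n' n'L.
have -> : \sum_(2 ^ L <= k < n) g k = \sum_(0 <= k < n') g (2 ^ L + k)%N.
  by rewrite -{1}[(2 ^ L)%N]add0n big_addn; apply: eq_bigr => k _; rewrite addnC.
set D := \sum_(0 <= k < n') _; set E := dyadic_energy L _ => hD.
have hA : N A ^+ 2 <= dyadic_energy L g := dyadic_energy_head L g.
have tri : N (A + D) <= N A + N D := cnormD _ _.
have NA := cnorm_ge0 A; have ND := cnorm_ge0 D.
apply: (le_trans (y := (N A + N D) ^+ 2)).
  by rewrite lerXn2r // ?nnegrE ?cnorm_ge0 ?addr_ge0.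
set M := N (\sum_(0 <= k < 2 ^ L.+1) g k).
apply: (le_trans (y := L.+2%:R * (N A ^+ 2 + E))); last first.
  rewrite ler_wpM2l ?ler0n //; have := sqr_ge0 M; lra.
have l0 : (1 : R) <= L.+1%:R by rewrite ler1n.
have -> : L.+2%:R = L.+1%:R + 1 :> R by rewrite -natr1.
set l := L.+1%:R in hD l0 *.
have : l * (N A + N D) ^+ 2 <= l * ((l + 1) * (N A ^+ 2 + E)).
  have h1 : 0 <= (l * N A - N D) ^+ 2 by apply: sqr_ge0.
  have h2 : N D ^+ 2 * (l + 1) <= l * E * (l + 1) by rewrite ler_wpM2r //; lra.
  nra.
by rewrite ler_pM2l //; lra.
Qed.

(** Each of the [L + 1] generations of dyadic intervals has total length
    [2 ^ L]. *)
Lemma dyadic_energy_sum_le (I : finType) (g : I -> nat -> C) (D : R) (L : nat) :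
  (forall s len, (len <= 2 ^ L)%N ->
     \sum_i N (\sum_(0 <= k < len) g i (s + k)%N) ^+ 2 <= len%:R * D) ->
  \sum_i dyadic_energy L (g i) <= L.+1%:R * (2 ^ L)%:R * D.
Proof.
elim: L g => [|L IH] g h.
  have := h 0%N 1%N isT; rewrite /= expn0 !mul1r; apply: le_trans.
  by apply: ler_sum => i _; rewrite big_nat1.
have leL : (2 ^ L <= 2 ^ L.+1)%N by rewrite leq_exp2l.
have h1 := h 0%N (2 ^ L.+1)%N (leqnn _).
have h2 : \sum_i dyadic_energy L (g i) <= L.+1%:R * (2 ^ L)%:R * D.
  by apply: IH => s len hl; apply: h; apply: leq_trans leL.
have h3 : \sum_i dyadic_energy L (fun k => g i (2 ^ L + k)%N) <= L.+1%:R * (2 ^ L)%:R * D.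
  apply: (IH (fun i k => g i (2 ^ L + k)%N)) => s len hl.
  have := h (2 ^ L + s)%N len (leq_trans hl leL).
  by under eq_bigr do under eq_bigr do rewrite -addnA.
rewrite /=; rewrite !big_split /=.
have -> : (2 ^ L.+1)%:R = 2 * (2 ^ L)%:R :> R by rewrite expnS natrM.
rewrite expnS natrM in h1.
have -> : L.+2%:R = L.+1%:R + 1 :> R by rewrite -natr1.
move: h1 h2 h3; rewrite expnS; lra.
Qed.

End Sums.

(** * Linear and bilinear sums of a shifted character *)

Section Bilinear.
Variable R : realType.
Local Notation C := R[i].
Local Notation N := (@Normc.normc R).
Variables (q : nat) (chi : 'F_q -> C).
Hypotheses (qp : prime q) (chiP : mult_char chi) (sum0 : \sum_x chi x = 0).

Lemma Fp_nat_eq0 k : (k%:R == 0 :> 'F_q) = (q %| k)%N.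
Proof. by rewrite -(dvdn_pcharf (pchar_Fp qp)). Qed.

(** After expanding the square, the pairs with equal residues number at
    most [len * (len / q + 1)] and cost [q] each; every other pair costs at
    most [1] by [mult_char_correlation]. *)
Lemma interval_mean_square (b : nat -> C) (B : R) (s len : nat) : 0 <= B ->
  (forall k, N (b k) <= B) ->
  \sum_(r : 'F_q) N (\sum_(0 <= k < len) b (s + k)%N * chi (r * (s + k)%:R - 1)) ^+ 2
    <= len%:R * (B ^+ 2 * (2 * len%:R + q%:R)).
Proof.
move=> B0 bB; have q0 := prime_gt0 qp.
pose g (r : 'F_q) k := chi (r * (s + k)%:R - 1).
pose cor k k' := \sum_r g r k * conjc (g r k').
pose d k k' : R := ((s + k)%:R == (s + k')%:R :> 'F_q)%:R.
have Fcard : (#|'F_q|%:R : R) = q%:R by rewrite card_Fp.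
have corP k k' : N (cor k k') <= q%:R * d k k' + 1.
  rewrite /cor /d; case: eqVneq => [e|ne]; last by rewrite mulr0 add0r mult_char_correlation.
  apply: le_trans (cnorm_sum _ _ _) _; rewrite mulr1.
  apply: (le_trans (y := \sum_(r : 'F_q) 1)).
    apply: ler_sum => r _; rewrite Normc.normcM cnorm_conj -[leRHS]mulr1.
    by rewrite ler_pM ?cnorm_ge0 ?mult_char_norm_le1.
  by rewrite sumr_const Fcard lerDl ler01.
have dsum k : \sum_(0 <= k' < len) d k k' <= (len %/ q).+1%:R.
  have := @sum_residues_le R q (fun x => (((s + k)%:R : 'F_q) == x)%:R) s len qp (fun x => ler0n _ _).
  have -> : \sum_(y : 'F_q) ((s + k)%:R == y)%:R = 1 :> R.
    rewrite (bigD1 ((s + k)%:R : 'F_q)) //= eqxx big1 ?addr0 // => y ny.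
    by rewrite eq_sym (negbTE ny).
  rewrite mulr1.
  rewrite -{1}[s]add0n big_addn addnC addnK => h; apply: le_trans h.
  by apply: ler_sum => k' _; rewrite /d [(k' + s)%N]addnC.
have eqn : ((\sum_(r : 'F_q) N (\sum_(0 <= k < len) b (s + k)%N * g r k) ^+ 2)%:C)%C
   = \sum_(0 <= k < len) \sum_(0 <= k' < len) b (s + k)%N * conjc (b (s + k')%N) * cor k k'.
  rewrite rmorph_sum /=.
  transitivity (\sum_(r : 'F_q) \sum_(0 <= k < len) \sum_(0 <= k' < len)
      b (s + k)%N * conjc (b (s + k')%N) * (g r k * conjc (g r k'))).
    apply: eq_bigr => r _; rewrite cnorm_sqr rmorph_sum /= mulr_suml.
    apply: eq_bigr => k _; rewrite mulr_sumr; apply: eq_bigr => k' _.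
    by rewrite rmorphM /= mulrACA.
  rewrite exchange_big /=; apply: eq_bigr => k _.
  rewrite exchange_big /=; apply: eq_bigr => k' _.
  by rewrite -mulr_sumr.
have ge0 : 0 <= \sum_(r : 'F_q) N (\sum_(0 <= k < len) b (s + k)%N * g r k) ^+ 2.
  by apply: sumr_ge0 => r _; apply: sqr_ge0.
rewrite -[leLHS](ger0_norm ge0) -cnormR eqn.
apply: le_trans (cnorm_sum _ _ _) _.
apply: (le_trans (y := \sum_(0 <= k < len) B ^+ 2 * (2 * len%:R + q%:R))); last first.
  by rewrite big_const_nat subn0 iter_addr_0 [leRHS]mulr_natl.
apply: ler_sum => k _; apply: le_trans (cnorm_sum _ _ _) _.
apply: (le_trans (y := \sum_(0 <= k' < len) B ^+ 2 * (q%:R * d k k' + 1))).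
  apply: ler_sum => k' _; rewrite !Normc.normcM cnorm_conj expr2.
  by rewrite !ler_pM ?mulr_ge0 ?cnorm_ge0.
rewrite -mulr_sumr ler_wpM2l ?sqr_ge0 // big_split /= -mulr_sumr.
rewrite big_const_nat subn0 iter_addr_0.
have h1 : q%:R * \sum_(0 <= k' < len) d k k' <= q%:R * (len %/ q).+1%:R by rewrite ler_wpM2l.
have h2 : q%:R * (len %/ q).+1%:R <= len%:R + q%:R :> R.
  by rewrite -natrM -natrD ler_nat mulnS addnC leq_add2r mulnC leq_divM.
lra.
Qed.

(** Over each full period the values [d * k - 1] run through all residues
    and the character sum vanishes. *)
Lemma complete_sum_le (d K : nat) : ~~ (q %| d)%N ->
  N (\sum_(0 <= k < K) chi ((d * k.+1)%:R - 1)) <= q%:R.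
Proof.
move=> qd; have q0 := prime_gt0 qp; have d0 : d%:R != 0 :> 'F_q by rewrite Fp_nat_eq0.
apply: periodic_sum_le => //.
- by move=> k; apply: mult_char_norm_le1.
- move=> k; congr (chi (_ - _)).
  by rewrite -addSn mulnDr natrD [X in _ + X]natrM pchar_Fp_0 // mulr0 addr0.
have := @sum_residues C q (fun x => chi (d%:R * (x + 1) - 1)) 0 qp; rewrite add0n.
under eq_bigr do rewrite natr1 -natrM.
move=> ->; rewrite -[RHS]sum0 [RHS](reindex_inj (h := fun x => d%:R * (x + 1) - 1)) //.
by move=> x y /addIr/(mulfI d0)/addIr.
Qed.

(** The shift by [1] comes from [phi l = l - 1]; the value [0] beyond [x] is what
    [vaughan] requires. *)
Definition shifted_cutoff (x n : nat) : C := if (n <= x)%N then chi (n%:R - 1) else 0.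

Lemma shifted_cutoff_gt x n : (x < n)%N -> shifted_cutoff x n = 0.
Proof. by rewrite /shifted_cutoff ltnNge => /negbTE->. Qed.

Lemma sum_shifted_cutoff (x b : nat) (L : nat -> C) : (0 < b)%N ->
  \sum_(1 <= k < x.+1) L k * shifted_cutoff x (b * k)%N =
  \sum_(0 <= k < x %/ b) L k.+1 * chi ((b * k.+1)%:R - 1).
Proof.
move=> b0; rewrite (big_cat_nat (n := (x %/ b).+1)) ?ltnS ?leq_div //=.
rewrite [X in _ + X]big1_seq ?addr0; last first.
  move=> k /andP[_]; rewrite mem_index_iota => /andP[k1 _].
  by rewrite shifted_cutoff_gt ?mulr0 // mulnC -ltn_divLR.
rewrite big_add1 /=; apply: eq_big_nat => k /andP[_ k1].
by rewrite /shifted_cutoff mulnC -leq_divRL // k1.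
Qed.

Lemma type_one (x b : nat) : (0 < b)%N -> ~~ (q %| b)%N ->
  N (\sum_(1 <= k < x.+1) shifted_cutoff x (b * k)%N) <= q%:R.
Proof.
move=> b0 qb; under eq_bigr do rewrite -[shifted_cutoff _ _]mul1r.
by rewrite (sum_shifted_cutoff _ (fun=> 1)) //; under eq_bigr do rewrite mul1r; apply: complete_sum_le.
Qed.

Lemma type_one_log (x b : nat) : (0 < b)%N -> ~~ (q %| b)%N ->
  N (\sum_(1 <= k < x.+1) ((ln k%:R : R)%:C)%C * shifted_cutoff x (b * k)%N)
    <= 2 * ln (x.+1)%:R * q%:R.
Proof.
move=> b0 qb; rewrite (sum_shifted_cutoff _ (fun k => ((ln k%:R : R)%:C)%C)) //.
apply: le_trans (@abel_sum_le R (fun k => ln (k.+1)%:R) (fun k => chi ((b * k.+1)%:R - 1)) q%:R _ _ _ _) _.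
- by rewrite ln1.
- by move=> k; rewrite ler_ln ?posrE ?ltr0n // ler_nat.
- by move=> n; apply: complete_sum_le.
rewrite ler_wpM2r ?ler0n // ler_wpM2l // ler_ln ?posrE ?ltr0n // ler_nat ltnS leq_div //.
Qed.

(** The length [n c] of the inner sum is freed by [rademacher_menshov]; after
    that, [c] enters only through its residue modulo [q] and can be extended to
    all residues. *)
Lemma bilinear_block (b : nat -> C) (B : R) (M L : nat) (n : nat -> nat) : 0 <= B ->
  (forall k, N (b k) <= B) -> (forall c, (M <= c)%N -> (n c <= 2 ^ L)%N) ->
  \sum_(M <= c < M + M) N (\sum_(0 <= m < n c) b m * chi ((c * m)%:R - 1)) ^+ 2 <=
   (L.+1%:R) ^+ 2 * (M %/ q).+1%:R * (2 ^ L)%:R * (B ^+ 2 * (2 * (2 ^ L)%:R + q%:R)).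
Proof.
move=> B0 bB nL; pose g (r : 'F_q) m := b m * chi (r * m%:R - 1).
apply: (le_trans (y := \sum_(M <= c < M + M) L.+1%:R * dyadic_energy L (g c%:R))).
  rewrite big_nat_cond [leRHS]big_nat_cond; apply: ler_sum => c /andP[/andP[Mc _] _].
  under eq_bigr do rewrite natrM.
  exact: (@rademacher_menshov R L (g c%:R) (n c) (nL c Mc)).
rewrite -mulr_sumr.
have h := @sum_residues_le R q (fun r => dyadic_energy L (g r)) M M qp (fun r => dyadic_energy_ge0 L (g r)).
have h2 : \sum_r dyadic_energy L (g r) <= L.+1%:R * (2 ^ L)%:R * (B ^+ 2 * (2 * (2 ^ L)%:R + q%:R)).
  apply: dyadic_energy_sum_le => s len hl; apply: le_trans (interval_mean_square s len B0 bB) _.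
  rewrite ler_wpM2l ?ler0n // ler_wpM2l ?sqr_ge0 // lerD2r ler_wpM2l //.
  by rewrite ler_nat.
apply: (le_trans (ler_wpM2l (ler0n _ _) h)).
apply: (le_trans (ler_wpM2l (ler0n _ _) (ler_wpM2l (ler0n _ _) h2))).
by rewrite le_eqVlt; apply/orP; left; apply/eqP; ring.
Qed.

End Bilinear.

Lemma sqr_sum_le (R : realFieldType) (I : Type) (r : seq I) (a : I -> R) :
  (\sum_(i <- r) a i) ^+ 2 <= (size r)%:R * \sum_(i <- r) a i ^+ 2.
Proof.
elim: r => [|i [|j r] IH]; first by rewrite !big_nil expr0n mulr0.
  by rewrite !big_seq1 mul1r.
rewrite [in leLHS]big_cons [in leRHS]big_cons [size _]/= -natr1.
move: IH; set S := \sum_(_ <- _) a _; set Q := \sum_(_ <- _) _; set n := (size _)%:R => IH.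
have n1 : 1 <= n by rewrite /n ler1n.
have : n * (a i + S) ^+ 2 <= n * ((n + 1) * (a i ^+ 2 + Q)).
  have h1 : 0 <= (n * a i - S) ^+ 2 by apply: sqr_ge0.
  have h2 : S ^+ 2 * (n + 1) <= n * Q * (n + 1) by rewrite ler_wpM2r //; lra.
  nra.
by rewrite ler_pM2l //; lra.
Qed.

Lemma dyadic_split (V : nmodType) (a : nat -> V) K :
  \sum_(1 <= c < 2 ^ K) a c = \sum_(0 <= i < K) \sum_(2 ^ i <= c < 2 ^ i + 2 ^ i) a c.
Proof.
elim: K => [|K IH]; first by rewrite expn0 !big_geq.
rewrite big_nat_recr //= -IH addnn -mul2n -expnS.
by rewrite (big_cat_nat (n := (2 ^ K)%N)) ?expn_gt0 ?leq_exp2l //.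
Qed.

Section PrimeSum.
Variable R : realType.
Local Notation C := R[i].
Local Notation N := (@Normc.normc R).

Lemma ln_nat_le (n T : nat) : (0 < n)%N -> (n <= 2 ^ T)%N -> ln n%:R <= T%:R :> R.
Proof.
move=> n0 nT; apply: (le_trans (y := ln (2 ^ T)%:R)).
  by rewrite ler_ln ?posrE ?ltr0n ?expn_gt0 // ler_nat.
rewrite natrX lnXn ?ltr0n // -[leRHS]mulr1 [leRHS]mulr_natl lerMn2r; apply/orP; right.
have : ln (1 + 1 : R) <= 1 by apply: le_ln1Dx; lra.
by rewrite -natr1.
Qed.

Lemma cnorm_moebius b : N (moebius b)%:~R <= 1.
Proof.
have -> : (moebius b)%:~R = (((moebius b)%:~R : R)%:C)%C by rewrite rmorph_int.
by rewrite cnormR -intr_norm (ler_int R _ 1) norm_moebius.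
Qed.

Lemma moebius_trunc_le U m : (0 < m)%N -> N (moebius_trunc C U m) <= (tau m)%:R.
Proof.
move=> m0; apply: le_trans (cnorm_sum _ _ _) _.
apply: (le_trans (y := \sum_(1 <= b < U.+1 | (b %| m)%N) 1%:R)).
  by apply: ler_sum => b _; apply: cnorm_moebius.
rewrite -natr_sum ler_nat sum1_count -size_filter; apply: uniq_leq_size.
  by rewrite filter_uniq // iota_uniq.
by move=> b; rewrite mem_filter -dvdn_divisors // => /andP[].
Qed.

Variables (q : nat) (chi : 'F_q -> C).
Hypotheses (qp : prime q) (chiP : mult_char chi) (sum0 : \sum_x chi x = 0).
Variables (u T : nat).
Let U := (u ^ 2)%N.
Let x := (q * u ^ 6)%N.
Hypotheses (u0 : (0 < u)%N) (Uq : (U < q)%N) (xT : (8 * x <= 2 ^ T)%N)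
  (tauT : forall n, (0 < n <= x)%N -> (tau n <= T)%N).

Let inner c := \sum_(U.+1 <= m < x.+1) moebius_trunc C U m * shifted_cutoff chi x (c * m)%N.

Let U0 : (0 < U)%N. Proof. by rewrite expn_gt0 u0. Qed.
Let q0 : (0 < q)%N. Proof. exact: prime_gt0. Qed.
Let x0 : (0 < x)%N. Proof. by rewrite muln_gt0 q0 expn_gt0 u0. Qed.
Let Ux : (U <= x)%N.
Proof. by rewrite /x; apply: leq_trans (ltnW Uq) _; rewrite leq_pmulr // expn_gt0 u0. Qed.

Let beta m := if (U < m <= x)%N then moebius_trunc C U m else 0.

Lemma type_two_inner c : (0 < c)%N ->
  inner c = \sum_(0 <= m < (x %/ c).+1) beta m * chi ((c * m)%:R - 1).
Proof.
move=> c0; transitivity (\sum_(0 <= m < x.+1) beta m * shifted_cutoff chi x (c * m)%N).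
  rewrite [RHS](big_cat_nat (n := U.+1)) ?ltnS //= [X in X + _]big1_seq ?add0r; last first.
    move=> m /andP[_]; rewrite mem_index_iota => /andP[_ mU].
    by rewrite /beta ltnNge -ltnS mU mul0r.
  by apply: eq_big_nat => m /andP[Um mx]; rewrite /beta Um -ltnS mx.
rewrite (big_cat_nat (n := (x %/ c).+1)) ?ltnS ?leq_div //= [X in _ + X]big1_seq ?addr0; last first.
  move=> m /andP[_]; rewrite mem_index_iota => /andP[m1 _].
  by rewrite shifted_cutoff_gt ?mulr0 // mulnC -ltn_divLR.
by apply: eq_big_nat => m /andP[_ m1]; rewrite /shifted_cutoff mulnC -leq_divRL // -ltnS m1 mulnC.
Qed.

Lemma type_two_zero c : (x < c * U.+1)%N -> inner c = 0.
Proof.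
move=> xc; rewrite /inner big1_seq // => m /andP[_]; rewrite mem_index_iota => /andP[Um _].
by rewrite shifted_cutoff_gt ?mulr0 //; apply: leq_trans xc _; rewrite leq_mul2l Um orbT.
Qed.

Let a c : R := if (U < c)%N then N (inner c) else 0.

(** By Cauchy's inequality and [bilinear_block], with [2 ^ L] between
    [x / M] and [4 x / M], the square of the block is at most a constant times
    [x T ^ 4 (x / q + M + x / M + q)].  Blocks that meet the range of summation
    have both [M] and [x / M] at most a constant times [x / U], and the
    choice [x = q u ^ 6], with [U = u ^ 2 < q], gives the same bound for [q]
    and for [x / q]. *)
Lemma type_two_block i :
  \sum_(2 ^ i <= c < 2 ^ i + 2 ^ i) a c <= 11 * x%:R * T%:R ^+ 2 / u%:R.
Proof.
set M := (2 ^ i)%N; have M0 : (0 < M)%N by rewrite expn_gt0.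
have a0 c : 0 <= a c by rewrite /a; case: ifP => // _; apply: cnorm_ge0.
have rhs0 : 0 <= 11 * x%:R * T%:R ^+ 2 / u%:R :> R.
  by rewrite divr_ge0 ?mulr_ge0 ?sqr_ge0 ?ler0n.
have [xM|Mx] := ltnP x (M * U.+1).
  rewrite big1_seq // => c /andP[_]; rewrite mem_index_iota => /andP[Mc _].
  rewrite /a type_two_zero ?Normc.normc0 ?if_same //.
  by apply: leq_trans xM _; rewrite leq_mul2r Mc orbT.
have [MU|UM] := leqP (M + M) U.
  rewrite big1_seq // => c /andP[_]; rewrite mem_index_iota => /andP[_ Mc].
  by rewrite /a ifF //; apply/negbTE; rewrite -leqNgt; apply: leq_trans (ltnW Mc) _.
set L := up_log 2 (x %/ M).+1.
have xM1 : (1 < (x %/ M).+1)%N.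
  by rewrite ltnS divn_gt0 //; apply: leq_trans Mx; rewrite leq_pmulr.
have XL : ((x %/ M).+1 <= 2 ^ L)%N by apply: up_logP.
have L0 : (0 < L)%N by rewrite up_log_gt0.
have XU : (M * 2 ^ L <= 4 * x)%N.
  have h : (2 ^ L.-1 < (x %/ M).+1)%N by apply: up_log_gtn.
  rewrite -(prednK L0) expnS.
  have h2 : (M * 2 ^ L.-1 <= x)%N.
    apply: (@leq_trans (M * (x %/ M))); last by rewrite mulnC leq_divM.
    by rewrite leq_mul2l -ltnS h orbT.
  by rewrite mulnCA; lia.
have LT : (L.+1 <= T)%N.
  rewrite -(leq_exp2l (m := 2)) // (leq_trans _ xT) // expnS.
  have : (2 ^ L <= M * 2 ^ L)%N by rewrite leq_pmull.
  lia.
have bT k : N (beta k) <= T%:R.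
  rewrite /beta; case: ifP => [/andP[Uk kx]|_]; last by rewrite Normc.normc0 ler0n.
  have k0 : (0 < k)%N by apply: leq_ltn_trans Uk.
  apply: le_trans (moebius_trunc_le U k0) _; rewrite ler_nat tauT ?k0 //.
have key := @bilinear_block R q chi qp chiP sum0 beta T%:R M L (fun c => (x %/ c).+1) (ler0n _ _) bT.
have {}key : \sum_(M <= c < M + M) N (inner c) ^+ 2 <=
   (L.+1%:R) ^+ 2 * (M %/ q).+1%:R * (2 ^ L)%:R * (T%:R ^+ 2 * (2 * (2 ^ L)%:R + q%:R)).
  apply: le_trans (key _); last first.
    by move=> c Mc; apply: leq_trans XL; rewrite ltnS leq_div2l.
  rewrite big_nat_cond [leRHS]big_nat_cond; apply: ler_sum => c /andP[/andP[Mc _] _].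
  by rewrite type_two_inner //; apply: leq_trans Mc.
have le1 : (\sum_(M <= c < M + M) a c) ^+ 2 <= M%:R * \sum_(M <= c < M + M) N (inner c) ^+ 2.
  apply: le_trans (sqr_sum_le _ _) _; rewrite size_iota addKn ler_wpM2l ?ler0n //.
  apply: ler_sum => c _; rewrite /a; case: ifP => // _; rewrite expr0n /= sqr_ge0 //.
have s0 : 0 <= \sum_(M <= c < M + M) a c by apply: sumr_ge0.
rewrite -(ler_pXn2r (n := 2)) ?nnegrE //; apply: (le_trans le1).
apply: (le_trans (ler_wpM2l (ler0n _ _) key)).
have Mq : (M %/ q).+1%:R <= M%:R / q%:R + 1 :> R.
  rewrite -natr1 lerD2r ler_pdivlMr ?ltr0n // -natrM ler_nat leq_divM //.
have qR : 0 < q%:R :> R by rewrite ltr0n.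
have uR : 1 <= u%:R :> R by rewrite ler1n.
have UR : U%:R = u%:R ^+ 2 :> R by rewrite natrX.
have xR : x%:R = q%:R * u%:R ^+ 6 :> R by rewrite natrM natrX.
have MX : M%:R * (2 ^ L)%:R <= 4 * x%:R :> R by rewrite -!natrM ler_nat.
have UMR : U%:R <= 2 * M%:R :> R by rewrite -natrM ler_nat mul2n -addnn ltnW.
have MxR : M%:R * U%:R <= x%:R :> R.
  by rewrite -natrM ler_nat (leq_trans _ Mx) // leq_mul2l leqnSn orbT.
have UqR : U%:R <= q%:R :> R by rewrite ler_nat ltnW.
have LTR : L.+1%:R ^+ 2 <= T%:R ^+ 2 :> R by rewrite lerXn2r ?nnegrE ?ler0n // ler_nat.
have MR : 0 < M%:R :> R by rewrite ltr0n.
have XR : 0 <= (2 ^ L)%:R :> R by rewrite ler0n.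
have xR0 : 0 <= x%:R :> R by rewrite ler0n.
move: MX XR LTR; set X := (2 ^ L)%:R; set l2 := L.+1%:R ^+ 2 => MX XR LTR.
set Y := (M %/ q).+1%:R in Mq *; set m := M%:R in MX UMR MxR MR Mq *.
set t2 := T%:R ^+ 2 in LTR *.
have t0 : 0 <= t2 by apply: sqr_ge0.
rewrite !exprMn exprVn -UR; set y := x%:R in xR0 xR MX MxR *; set v := U%:R in UR UMR MxR UqR *.
have v1 : 1 <= v by rewrite UR exprn_ege1.
have v0 : 0 < v by lra.
have Y0 : 0 <= Y by apply: ler0n.
have core : m * X * (Y * (2 * X + q%:R)) <= 121 * y ^+ 2 / v.
  have qy : q%:R * v <= y.
    by rewrite xR ler_pM2l // UR ler_weXn2l.
  have Xv : X * v <= 8 * y.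
    have : X * v <= X * (2 * m) by rewrite ler_wpM2l.
    lra.
  have B1 : Y * (2 * X + q%:R) <= 2 * (m * X) / q%:R + m + 2 * X + q%:R.
    apply: (le_trans (y := (m / q%:R + 1) * (2 * X + q%:R))).
      by rewrite ler_wpM2r // addr_ge0 ?mulr_ge0 // ltW.
    by rewrite le_eqVlt; apply/orP; left; apply/eqP; field; lra.
  have B2 : 2 * (m * X) / q%:R <= 8 * y / v.
    rewrite ler_pdivrMr // mulrAC ler_pdivlMr //.
    have : m * X * v <= 4 * y * q%:R.
      by apply: ler_pM => //; rewrite ?mulr_ge0 // ltW.
    lra.
  have B3 : m + 2 * X + q%:R <= 18 * y / v by rewrite ler_pdivlMr //; lra.
  have B4 : Y * (2 * X + q%:R) <= 26 * y / v.
    have e : 8 * y / v + 18 * y / v = 26 * y / v by rewrite -mulrDl; congr (_ / v); ring.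
    lra.
  apply: (le_trans (y := 4 * y * (26 * y / v))).
    apply: ler_pM => //; first by rewrite mulr_ge0 // ltW.
    by rewrite mulr_ge0 // addr_ge0 ?mulr_ge0 // ltW.
  rewrite mulrA ler_pM2r ?invr_gt0 //.
  by have := sqr_ge0 y; nra.
have -> : m * (l2 * Y * X * (t2 * (2 * X + q%:R))) = l2 * (t2 * (m * X * (Y * (2 * X + q%:R)))).
  by ring.
have core0 : 0 <= m * X * (Y * (2 * X + q%:R)).
  by rewrite !mulr_ge0 // ?addr_ge0 ?mulr_ge0 // ltW.
apply: (le_trans (y := t2 * (t2 * (121 * y ^+ 2 / v)))).
  apply: ler_pM => //; [exact: sqr_ge0|exact: mulr_ge0|by rewrite ler_wpM2l].
by rewrite le_eqVlt; apply/orP; left; apply/eqP; rewrite /t2; field; lra.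
Qed.

(** The range of [c] is cut into at most [T] dyadic blocks, which costs one
    factor [T]; another one comes from the von Mangoldt function. *)
Lemma type_two :
  N (\sum_(U.+1 <= c < x.+1) ((vonMangoldt R c)%:C)%C * inner c) <= 11 * x%:R * T%:R ^+ 4 / u%:R.
Proof.
have a0 c : 0 <= a c by rewrite /a; case: ifP => // _; apply: cnorm_ge0.
apply: le_trans (cnorm_sum _ _ _) _.
apply: (le_trans (y := T%:R * \sum_(1 <= c < 2 ^ T) a c)); last first.
  rewrite dyadic_split.
  apply: (le_trans (y := T%:R * \sum_(0 <= i < T) (11 * x%:R * T%:R ^+ 2 / u%:R))).
    by rewrite ler_wpM2l ?ler0n //; apply: ler_sum => i _; apply: type_two_block.
  rewrite big_const_nat subn0 iter_addr_0 -[X in _ * X <= _]mulr_natl.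
  by rewrite le_eqVlt; apply/orP; left; apply/eqP; ring.
have x2 : (x.+1 <= 2 ^ T)%N by apply: leq_trans xT; lia.
rewrite mulr_sumr (big_cat_nat (n := U.+1) (m := 1)) //=; last first.
  by apply: leq_trans x2; rewrite ltnS.
rewrite [X in _ <= _ + X](big_cat_nat (n := x.+1)) //= ?ltnS //.
rewrite addrCA -[leLHS]addr0; apply: lerD; last first.
  by rewrite addr_ge0 // sumr_ge0 // => c _; rewrite mulr_ge0 ?ler0n.
rewrite big_nat_cond [leRHS]big_nat_cond; apply: ler_sum => c /andP[/andP[Uc cx] _].
rewrite Normc.normcM cnormR ger0_norm ?vonMangoldt_ge0 // /a Uc ler_wpM2r ?cnorm_ge0 //.
have c0 : (0 < c)%N by apply: leq_trans Uc.
apply: le_trans (vonMangoldt_le R c0) (ln_nat_le c0 _).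
by apply: leq_trans x2; apply: ltnW.
Qed.

End PrimeSum.

(** * The sum of a character over shifted primes *)

Lemma prime_sum_arith (R : realFieldType) (v t s w1 w2 w3 w4 w5 : R) :
  1 <= v -> 1 <= t -> 1 <= s ->
  w1 <= v ^+ 2 * (2 * t * s) -> w2 <= v ^+ 2 * (t * (v ^+ 2 * s)) ->
  w3 <= v ^+ 2 * t -> w4 <= 11 * (s * v ^+ 5 * t ^+ 4) -> w5 <= s * v ^+ 5 * t * t ->
  w1 + w2 + w3 + w4 + w5 <= 16 * (s * v ^+ 5 * t ^+ 4).
Proof.
move=> u1 t1 q1 S1 S2 S3 S4 S5.
have mono i j : (i <= 5)%N -> (j <= 4)%N -> s * v ^+ i * t ^+ j <= s * v ^+ 5 * t ^+ 4.
  move=> i5 j4; have s0 : 0 <= s by lra.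
  have v0 : 0 <= v by lra.
  have t0 : 0 <= t by lra.
  apply: ler_pM; rewrite ?mulr_ge0 ?exprn_ge0 //.
    by rewrite ler_wpM2l ?ler_weXn2l.
  by rewrite ler_weXn2l.
have m1 := mono 2%N 1%N isT isT; have m2 := mono 4%N 1%N isT isT.
have m3 := mono 5%N 2%N isT isT.
have v20 : 0 <= v ^+ 2 * t by rewrite mulr_ge0 ?sqr_ge0 //; lra.
have m4 : v ^+ 2 * t <= s * v ^+ 2 * t ^+ 1.
  by rewrite expr1 -mulrA -[leLHS]mul1r ler_wpM2r.
rewrite !expr1 in m1 m2 m4.
have e2 : v ^+ 2 * (t * (v ^+ 2 * s)) = s * v ^+ 4 * t by ring.
have e5 : s * v ^+ 5 * t * t = s * v ^+ 5 * t ^+ 2 by ring.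
rewrite e2 in S2; rewrite e5 in S5.
have e1 : v ^+ 2 * (2 * t * s) = 2 * (s * v ^+ 2 * t) by ring.
rewrite e1 in S1; lra.
Qed.

Section PrimePowers.
Variable R : realType.

(** Proper prime powers up to [x] have their prime at most [Y] and their exponent
    below [T]. *)
Lemma prime_power_sum_le (x Y T : nat) : (x < Y.+1 ^ 2)%N -> (x < 2 ^ T)%N ->
  \sum_(1 <= n < x.+1 | ~~ prime n) vonMangoldt R n <= Y%:R * T%:R * T%:R.
Proof.
move=> xY xT.
apply: (le_trans (y := \sum_(1 <= n < x.+1) \sum_(1 <= p < Y.+1) \sum_(0 <= e < T)
    (if n == (p ^ e)%N then T%:R else 0 : R))).
  have s0 n p : 0 <= \sum_(0 <= e < T) (if n == (p ^ e)%N then T%:R else 0 : R).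
    by apply: sumr_ge0 => e _; case: ifP.
  rewrite big_mkcond big_nat_cond [leRHS]big_nat_cond; apply: ler_sum => n /andP[/andP[n0 nx] _]; rewrite ltnS in nx.
  have ss0 : 0 <= \sum_(1 <= p < Y.+1) \sum_(0 <= e < T) (if n == (p ^ e)%N then T%:R else 0 : R).
    by apply: sumr_ge0.
  case: ifP => // npr; have [->//|/vonMangoldt_neq0[p [e [pp e0 ne]]]] := eqVneq (vonMangoldt R n) 0.
  have p1 := prime_gt1 pp.
  have e1 : (1 < e)%N.
    by case: e e0 ne => [//|[_ ne|//]]; rewrite ne expn1 pp in npr.
  have eT : (e < T)%N.
    rewrite -(ltn_exp2l (m := 2)) //; apply: leq_ltn_trans xT.
    by apply: leq_trans nx; rewrite ne expn_mono.
  have pY : (0 < p < Y.+1)%N.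
    rewrite (ltnW p1) /= -(@ltn_exp2r p Y.+1 2) //; apply: leq_ltn_trans xY.
    by apply: leq_trans nx; rewrite ne leq_pexp2l // ltnW.
  rewrite (bigD1_seq p) ?iota_uniq ?mem_index_iota //= (bigD1_seq e) ?iota_uniq ?mem_index_iota //=.
  rewrite ne eqxx -addrA -ne ler_wpDr ?addr_ge0 ?sumr_ge0 //.
    by move=> i _; case: ifP.
  apply: le_trans (vonMangoldt_le R n0) (ln_nat_le R n0 _).
  exact: (leq_trans nx (ltnW xT)).
rewrite exchange_big /=.
apply: (le_trans (y := \sum_(1 <= p < Y.+1) (T%:R * T%:R))); last first.
  by rewrite big_const_nat subn1 iter_addr_0 -mulrA [leRHS]mulr_natl.
apply: ler_sum => p _; rewrite exchange_big /=.
apply: (le_trans (y := \sum_(0 <= e < T) T%:R)); last first.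
  by rewrite big_const_nat subn0 iter_addr_0 [leRHS]mulr_natl.
apply: ler_sum => e _; rewrite -big_mkcond big_nat1_eq; case: ifP => //.
Qed.

End PrimePowers.

Section PrimeSum.
Variable R : realType.
Local Notation C := R[i].
Local Notation N := (@Normc.normc R).

(** Vaughan's identity with both cuts at [u ^ 2].  The linear sums contribute
    [u ^ 4 * q * T], and the bilinear sums [x * T ^ 4 / u]; these and the
    prime powers are all of order at most [q * u ^ 5 * T ^ 4], which is smaller than [x]
    by a factor [u / T ^ 4]. *)
Lemma prime_char_sum (q : nat) (chi : 'F_q -> C) (u T : nat) :
  prime q -> mult_char chi -> \sum_x chi x = 0 ->
  (0 < u)%N -> (u ^ 2 < q)%N -> (8 * (q * u ^ 6) <= 2 ^ T)%N ->
  (forall n, (0 < n <= q * u ^ 6)%N -> (tau n <= T)%N) ->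
  N (\sum_(1 <= l < (q * u ^ 6).+1 | prime l) ((ln l%:R : R)%:C)%C * chi (l%:R - 1))
    <= 16 * (q%:R * u%:R ^+ 5 * T%:R ^+ 4).
Proof.
move=> qp chiP sum0 u0 Uq xT tauT.
set x := (q * u ^ 6)%N in xT tauT *; set U := (u ^ 2)%N in Uq.
have U0 : (0 < U)%N by rewrite expn_gt0 u0.
have q0 := prime_gt0 qp.
have x0 : (0 < x)%N by rewrite muln_gt0 q0 expn_gt0 u0.
have Ux : (U <= x)%N.
  by rewrite /x; apply: leq_trans (ltnW Uq) _; rewrite leq_pmulr // expn_gt0 u0.
have x2 : (x.+1 <= 2 ^ T)%N by apply: leq_trans xT; lia.
have T1 : (1 <= T)%N by apply: leq_trans (tauT 1%N _); rewrite ?x0.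
pose Lam c : C := ((vonMangoldt R c)%:C)%C.
pose G := shifted_cutoff chi x.
have NG n : N (G n) <= 1.
  by rewrite /G /shifted_cutoff; case: ifP => _; rewrite ?Normc.normc0 ?ler01 ?mult_char_norm_le1.
have NLam c : (0 < c <= x)%N -> N (Lam c) <= T%:R.
  move=> /andP[c0 cx]; rewrite cnormR ger0_norm ?vonMangoldt_ge0 //.
  apply: le_trans (vonMangoldt_le R c0) (ln_nat_le R c0 _).
  by apply: leq_trans x2; apply: leq_trans cx _.
have nd b : (0 < b <= U)%N -> ~~ (q %| b)%N.
  by move=> /andP[b0 bU]; rewrite gtnNdvd //; apply: leq_ltn_trans Uq.
have V := @vaughan C Lam (fun k => ((ln k%:R : R)%:C)%C) G x U U _ _ Ux (fun n => @shifted_cutoff_gt R q chi x n).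
have {}V : \sum_(1 <= c < x.+1) Lam c * G c =
    \sum_(1 <= b < U.+1) (moebius b)%:~R * (\sum_(1 <= k < x.+1) ((ln k%:R : R)%:C)%C * G (b * k)%N)
  - \sum_(1 <= c < U.+1) Lam c * (\sum_(1 <= b < U.+1) (moebius b)%:~R *
       \sum_(1 <= d < x.+1) G (c * (b * d))%N)
  + \sum_(1 <= c < U.+1) Lam c * G c
  - \sum_(U.+1 <= c < x.+1) Lam c *
       \sum_(U.+1 <= m < x.+1) moebius_trunc C U m * G (c * m)%N.
  by apply: V; rewrite ?U0 // => k kx; rewrite /Lam -rmorph_sum /= sum_vonMangoldt.
have := type_two qp chiP sum0 u0 Uq xT tauT; rewrite -/x -/U => S4.
set W1 := \sum_(1 <= b < U.+1) _ * _ in V.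
set W2 := \sum_(1 <= c < U.+1) _ * _ in V.
set W3 := \sum_(1 <= c < U.+1) _ * _ in V.
set W4 := \sum_(U.+1 <= c < x.+1) _ * _ in V.
have {}S4 : N W4 <= 11 * x%:R * T%:R ^+ 4 / u%:R := S4.
have S1 : N W1 <= U%:R * (2 * T%:R * q%:R).
  apply: le_trans (cnorm_sum _ _ _) _.
  apply: (le_trans (y := \sum_(1 <= b < U.+1) (2 * T%:R * q%:R))); last first.
    by rewrite big_const_nat subn1 iter_addr_0 [leRHS]mulr_natl.
  rewrite big_nat_cond [leRHS]big_nat_cond; apply: ler_sum => b /andP[/andP[b0 bU] _].
  rewrite Normc.normcM -[leRHS]mul1r ler_pM ?cnorm_ge0 ?cnorm_moebius //.
  apply: le_trans (type_one_log qp chiP sum0 x b0 _) _; first by apply: nd; rewrite b0.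
  by rewrite ler_wpM2r ?ler0n // ler_wpM2l // ln_nat_le.
have S2 : N W2 <= U%:R * (T%:R * (U%:R * q%:R)).
  apply: le_trans (cnorm_sum _ _ _) _.
  apply: (le_trans (y := \sum_(1 <= c < U.+1) (T%:R * (U%:R * q%:R)))); last first.
    by rewrite big_const_nat subn1 iter_addr_0 [leRHS]mulr_natl.
  rewrite big_nat_cond [leRHS]big_nat_cond; apply: ler_sum => c /andP[/andP[c0 cU] _]; rewrite ltnS in cU.
  rewrite Normc.normcM ler_pM ?cnorm_ge0 ?NLam ?c0 //=; first exact: leq_trans cU Ux.
  apply: le_trans (cnorm_sum _ _ _) _.
  apply: (le_trans (y := \sum_(1 <= b < U.+1) q%:R)); last first.
    by rewrite big_const_nat subn1 iter_addr_0 [leRHS]mulr_natl.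
  rewrite big_nat_cond [leRHS]big_nat_cond; apply: ler_sum => b /andP[/andP[b0 bU] _].
  rewrite Normc.normcM -[leRHS]mul1r ler_pM ?cnorm_ge0 ?cnorm_moebius //.
  under eq_bigr do rewrite mulnA.
  apply: type_one => //; first by rewrite muln_gt0 c0.
  by rewrite Euclid_dvdM // negb_or !nd ?c0 ?b0.
have S3 : N W3 <= U%:R * T%:R.
  apply: le_trans (cnorm_sum _ _ _) _.
  apply: (le_trans (y := \sum_(1 <= c < U.+1) T%:R)); last first.
    by rewrite big_const_nat subn1 iter_addr_0 [leRHS]mulr_natl.
  rewrite big_nat_cond [leRHS]big_nat_cond; apply: ler_sum => c /andP[/andP[c0 cU] _]; rewrite ltnS in cU.
  rewrite Normc.normcM -[leRHS]mulr1 ler_pM ?cnorm_ge0 ?NLam ?c0 //=.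
  exact: leq_trans cU Ux.
have S5 : N (\sum_(1 <= c < x.+1 | ~~ prime c) Lam c * G c) <= (q * u ^ 5)%:R * T%:R * T%:R.
  apply: le_trans (cnorm_sum _ _ _) _.
  apply: le_trans (prime_power_sum_le (x := x) (Y := (q * u ^ 5)%N) R _ x2); last first.
    apply: (@leq_trans (((q * u ^ 5) ^ 2).+1)%N); last by rewrite ltn_exp2r.
    by rewrite ltnS /x -mulnn mulnACA -expnD; apply: leq_mul; rewrite ?leq_pmulr ?leq_pexp2l.
  apply: ler_sum => c _; rewrite Normc.normcM cnormR ger0_norm ?vonMangoldt_ge0 //.
  by rewrite -[leRHS]mulr1 ler_wpM2l ?vonMangoldt_ge0.
have -> : \sum_(1 <= l < x.+1 | prime l) ((ln l%:R : R)%:C)%C * chi (l%:R - 1) =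
    W1 - W2 + W3 - W4 - \sum_(1 <= c < x.+1 | ~~ prime c) Lam c * G c.
  rewrite -V [X in _ = X - _](bigID prime) /= addrK big_nat_cond [RHS]big_nat_cond.
  apply: eq_bigr => l /andP[/andP[l0 lx] lp].
  by rewrite /Lam vonMangoldt_prime // /G /shifted_cutoff -ltnS lx.
apply: le_trans (cnormB _ _) _; move: S5; set w5 := N (\sum_(_ <= _ < _ | _) _) => S5.
have B1 : N (W1 - W2 + W3 - W4) <= N W1 + N W2 + N W3 + N W4.
  apply: le_trans (cnormB _ _) _; rewrite lerD2r.
  apply: le_trans (cnormD _ _) _; rewrite lerD2r.
  exact: cnormB.
have u1 : 1 <= u%:R :> R by rewrite ler1n.
have t1 : 1 <= T%:R :> R by rewrite ler1n.
have q1 : 1 <= q%:R :> R by rewrite ler1n.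
have xE : 11 * x%:R * T%:R ^+ 4 / u%:R = 11 * (q%:R * u%:R ^+ 5 * T%:R ^+ 4) :> R.
  have un0 : u%:R != 0 :> R by rewrite pnatr_eq0 -lt0n.
  by rewrite /x natrM natrX; field.
rewrite xE in S4; move: S1 S2 S3 S5; rewrite /U natrX natrM natrX => S1 S2 S3 S5.
apply: le_trans (prime_sum_arith u1 t1 q1 S1 S2 S3 S4 S5).
by rewrite lerD2r.
Qed.

End PrimeSum.

(** * Mean values over all characters *)

Section Moments.
Variables (R : realType) (F : finFieldType).
Local Notation C := R[i].
Local Notation N := (@Normc.normc R).
Let n := #|F|.-1.
Variable X : 'I_n -> F -> C.
Hypotheses (XP : forall j, mult_char (X j))
  (Xorth : forall x y : F, x != 0 -> y != 0 ->
        \sum_j X j x * conjc (X j y) = n%:R * (x == y)%:R).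

Lemma character_orthogonality x y : y != 0 ->
  \sum_j X j x * conjc (X j y) = n%:R * (x == y)%:R.
Proof.
move=> y0; have [->|x0] := eqVneq x 0; last exact: Xorth.
rewrite eq_sym (negbTE y0) mulr0 big1 // => j _.
by rewrite (mult_char_zero (XP j)) mul0r.
Qed.

(** Orthogonality leaves only the pairs of indices with the same value of
    [v]; pairs with [v i = 0] contribute nothing on the left, whence an
    inequality. *)
Lemma parseval_le (I : Type) (r : seq I) (P : pred I) (a : I -> R) (v : I -> F) :
  (forall i, P i -> 0 <= a i) ->
  \sum_j N (\sum_(i <- r | P i) (a i)%:C%C * X j (v i)) ^+ 2 <=
   n%:R * \sum_(i <- r | P i) \sum_(i' <- r | P i') a i * a i' * (v i == v i')%:R.
Proof.
move=> a0.
have orth i i' : N (\sum_j X j (v i) * conjc (X j (v i'))) <= n%:R * (v i == v i')%:R.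
  have [e|v0] := eqVneq (v i') 0.
    rewrite big1 ?Normc.normc0 ?mulr_ge0 ?ler0n // => j _.
    by rewrite e (mult_char_zero (XP j)) rmorph0 mulr0.
  have -> : n%:R * (v i == v i')%:R = `|n%:R * (v i == v i')%:R| :> R.
    by rewrite ger0_norm ?mulr_ge0 ?ler0n.
  by rewrite character_orthogonality // -cnormR rmorphM !rmorph_nat.
have cj (t : R) (z : C) : conjc (t%:C%C * z) = t%:C%C * conjc z.
  by rewrite rmorphM; congr (_ * _); apply: conjc_real.
have eqn : ((\sum_j N (\sum_(i <- r | P i) (a i)%:C%C * X j (v i)) ^+ 2)%:C)%C =
   \sum_(i <- r | P i) \sum_(i' <- r | P i') ((a i * a i')%:C)%C *
      \sum_j X j (v i) * conjc (X j (v i')).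
  rewrite rmorph_sum /=.
  transitivity (\sum_j \sum_(i <- r | P i) \sum_(i' <- r | P i') ((a i * a i')%:C)%C *
      (X j (v i) * conjc (X j (v i')))).
    apply: eq_bigr => j _; rewrite cnorm_sqr rmorph_sum /= mulr_suml.
    apply: eq_bigr => k _; rewrite mulr_sumr; apply: eq_bigr => k' _.
    by rewrite cj [((_ * _)%:C)%C]rmorphM mulrACA.
  rewrite exchange_big /=; apply: eq_bigr => k _.
  rewrite exchange_big /=; apply: eq_bigr => k' _.
  by rewrite -mulr_sumr.
have ge0 : 0 <= \sum_j N (\sum_(i <- r | P i) (a i)%:C%C * X j (v i)) ^+ 2.
  by apply: sumr_ge0 => j _; apply: sqr_ge0.
rewrite -[leLHS](ger0_norm ge0) -cnormR eqn.
apply: le_trans (cnorm_sum _ _ _) _; rewrite mulr_sumr; apply: ler_sum => i Pi.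
apply: le_trans (cnorm_sum _ _ _) _; rewrite mulr_sumr; apply: ler_sum => i' Pi'.
have aa : 0 <= a i * a i' by rewrite mulr_ge0 ?a0.
by rewrite Normc.normcM cnormR ger0_norm // mulrCA ler_wpM2l.
Qed.

Lemma mult_char_bigprod (chi : F -> C) (I : Type) (r : seq I) (v : I -> F) : mult_char chi ->
  \prod_(i <- r) chi (v i) = chi (\prod_(i <- r) v i).
Proof. by move=> cP; rewrite (big_morph chi (mult_char_mul cP) (mult_char_one cP)). Qed.

End Moments.

Lemma pred_natr (A : pzRingType) p : prime p -> p%:R - 1 = p.-1%:R :> A.
Proof. by move=> /prime_gt0 p0; rewrite -{1}(prednK p0) -natr1 addrK. Qed.

Section Counting.
Variable R : realType.
Local Notation C := R[i].
Local Notation N := (@Normc.normc R).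
Variable q : nat.
Hypothesis qp : prime q.
Local Notation F := 'F_q.
Let n := #|F|.-1.
Variable X : 'I_n -> F -> C.
Hypotheses (XP : forall j, mult_char (X j))
  (Xorth : forall x y : F, x != 0 -> y != 0 ->
        \sum_j X j x * conjc (X j y) = n%:R * (x == y)%:R).

Let q0 : (0 < q)%N. Proof. exact: prime_gt0. Qed.

Lemma Fp_nat_inj a b : (a < q)%N -> (b < q)%N -> a%:R = b%:R :> F -> a = b.
Proof.
move=> aq bq /(congr1 val); rewrite /= !val_Fp_nat // !modn_small //.
Qed.

(** The [k]-th power of the sum is a sum over [k]-tuples of primes.  By
    [parseval_le] the moment counts pairs of tuples for which the products of the
    [p - 1] are congruent modulo [q].  These products are below [q], so they are
    equal; then every entry of the second tuple is determined by a divisor of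
    the product of the first, which leaves at most [T ^ k] tuples. *)
Lemma small_prime_moment (z k T : nat) : (z ^ k < q)%N ->
  (forall m, (0 < m < q)%N -> (tau m <= T)%N) ->
  \sum_j N (\sum_(1 <= p < z.+1 | prime p) X j (p%:R - 1)) ^+ (k + k) <=
    n%:R * (\sum_(1 <= p < z.+1 | prime p) 1) ^+ k * T%:R ^+ k.
Proof.
move=> zkq tauT.
pose J := 'I_z.+1; pose w (f : {ffun 'I_k -> J}) : R := \prod_i (prime (f i))%:R.
pose A (f : {ffun 'I_k -> J}) := (\prod_i (f i : nat).-1)%N.
have sumJ (V : nmodType) (G : nat -> V) :
    \sum_(1 <= p < z.+1 | prime p) G p = \sum_(p : J) (if prime p then G p else 0).
  rewrite big_mkcond; rewrite -(big_mkord xpredT (fun p => if prime p then G p else 0)).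
  by rewrite [RHS]big_ltn //= add0r.
have tk j : (\sum_(1 <= p < z.+1 | prime p) X j (p%:R - 1)) ^+ k =
    \sum_(f : {ffun 'I_k -> J}) (w f)%:C%C * X j (A f)%:R.
  rewrite sumJ -[LHS](_ : \prod_(i < k) \sum_(p : J) (if prime p then X j (p%:R - 1) else 0) = _);
    last by rewrite prodr_const card_ord.
  rewrite bigA_distr_bigA /=; apply: eq_bigr => f _.
  rewrite /w /A natr_prod -mult_char_bigprod // rmorph_prod -big_split /=.
  apply: eq_bigr => i _; case: ifP => fp; last by rewrite rmorph0 mul0r.
  by rewrite rmorph1 mul1r pred_natr.
have w01 f : w f = 0 \/ (w f = 1 /\ forall i, prime (f i)).
  have [/forallP h|] := boolP [forall i, prime (f i)].
    by right; split => //; rewrite /w big1 // => i _; rewrite h.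
  by rewrite negb_forall => /existsP[i hi]; left; rewrite /w (bigD1 i) //= (negbTE hi) mul0r.
have w0 f : 0 <= w f by case: (w01 f) => [->|[->]].
have Ab (f : {ffun 'I_k -> J}) : (forall i, prime (f i)) -> (0 < A f < q)%N.
  move=> fp; apply/andP; split.
    rewrite /A prodn_gt0 // => i; have := prime_gt1 (fp i); lia.
  apply: leq_ltn_trans zkq; rewrite -[X in (_ <= z ^ X)%N](card_ord k) -prod_nat_const.
  apply: leq_prod => i _; have := ltn_ord (f i); lia.
have energy (f : {ffun 'I_k -> J}) : w f = 1 -> \sum_(g : {ffun 'I_k -> J}) w g * ((A f)%:R == (A g)%:R :> F)%:R <= T%:R ^+ k.
  move=> wf; have fp : forall i, prime (f i).
    by case: (w01 f) => [e|[]//]; move: wf; rewrite e => /eqP; rewrite eq_sym oner_eq0.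
  pose D := [pred p : J | prime p && ((p : nat).-1 %| A f)%N].
  apply: (le_trans (y := \sum_(g in ffun_on D) 1)).
    rewrite [leRHS]big_mkcond; apply: ler_sum => g _.
    case: (w01 g) => [->|[-> gp]]; first by rewrite mul0r; case: ifP.
    rewrite mul1r; case: eqVneq => [e|_]; last by case: ifP.
    rewrite ifT //; apply/ffun_onP => i; rewrite inE gp /=.
    have /andP[_ hf] := Ab f fp; have /andP[_ hg] := Ab g gp.
    rewrite (Fp_nat_inj hf hg e) /A (bigD1 i) //= dvdn_mulr //.
  rewrite sumr_const card_ffun_on card_ord -natrX ler_nat expn_mono //.
  apply: leq_trans (tauT _ (Ab f fp)).
  have Af0 : (0 < A f)%N by have /andP[] := Ab f fp.
  rewrite cardE -(size_map (fun p : J => (p : nat).-1)); apply: uniq_leq_size.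
    rewrite map_inj_in_uniq ?enum_uniq // => a b; rewrite !mem_enum !inE => /andP[ap _] /andP[bp _] e.
    apply: val_inj => /=; have := prime_gt0 ap; have := prime_gt0 bp; lia.
  move=> m /mapP[p]; rewrite mem_enum inE => /andP[_ h ->].
  by rewrite -dvdn_divisors.
apply: (le_trans (y := \sum_j N (\sum_(f : {ffun 'I_k -> J}) (w f)%:C%C * X j (A f)%:R) ^+ 2)).
  by apply: ler_sum => j _; rewrite -tk cnormX -exprM muln2 addnn.
apply: le_trans (parseval_le XP Xorth _ _ _) _; first by move=> f _; apply: w0.
rewrite -mulrA ler_wpM2l ?ler0n //.
have -> : (\sum_(1 <= p < z.+1 | prime p) 1) ^+ k = \sum_(f : {ffun 'I_k -> J}) w f.
  rewrite sumJ -[LHS](_ : \prod_(i < k) \sum_(p : J) (if prime p then 1 else 0) = _);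
    last by rewrite prodr_const card_ord.
  rewrite bigA_distr_bigA /=; apply: eq_bigr => f _; apply: eq_bigr => i _.
  by case: (prime _).
rewrite mulr_suml; apply: ler_sum => f _.
under eq_bigr do rewrite -mulrA; rewrite -mulr_sumr.
by case: (w01 f) => [->|[w1 _]]; rewrite ?mul0r // w1 !mul1r energy.
Qed.

(** By [parseval_le] only congruent pairs count, and each of the at most [x]
    primes is congruent to at most [x / q + 1] numbers up to [x]. *)
Lemma large_prime_mean_square (x T : nat) : (q <= x)%N -> (x < 2 ^ T)%N ->
  \sum_j N (\sum_(1 <= l < x.+1 | prime l) ((ln l%:R : R)%:C)%C * X j (l%:R - 1)) ^+ 2 <=
    2 * x%:R ^+ 2 * T%:R ^+ 2.
Proof.
move=> qx xT.
apply: le_trans (parseval_le XP Xorth _ _ _) _.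
  by move=> l /prime_gt0 l0; rewrite ln_ge0 // ler1n.
have lnT l : (0 < l < x.+1)%N -> 0 <= (ln l%:R : R) <= T%:R.
  move=> /andP[l0 lx]; rewrite ln_ge0 ?ler1n //= ln_nat_le //.
  by apply: ltnW; apply: leq_ltn_trans xT.
have cnt (l : nat) : \sum_(1 <= l' < x.+1 | prime l') ((l%:R - 1 == l'%:R - 1 :> F)%:R : R) <=
   (x %/ q).+1%:R.
  rewrite big_mkcond; apply: (le_trans (y := \sum_(1 <= l' < 1 + x) ((l%:R == l'%:R :> F)%:R : R))).
    apply: ler_sum => l' _; rewrite (inj_eq (addIr _)); case: ifP => //.
  apply: le_trans (sum_residues_le (h := fun y => (l%:R == y)%:R) _ _ qp _) _; first by move=> y; apply: ler0n.
  rewrite (bigD1 (l%:R : F)) //= eqxx big1 ?addr0 ?mulr1 // => y ny.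
  by rewrite eq_sym (negbTE ny).
apply: (le_trans (y := n%:R * (x%:R * (T%:R * (T%:R * (x %/ q).+1%:R))))).
  rewrite ler_wpM2l ?ler0n //.
  apply: (le_trans (y := \sum_(1 <= l < x.+1) (T%:R * (T%:R * (x %/ q).+1%:R)))); last first.
    by rewrite big_const_nat subn1 iter_addr_0 [leRHS]mulr_natl.
  have t0 : 0 <= T%:R * (T%:R * (x %/ q).+1%:R) :> R by rewrite !mulr_ge0 ?ler0n.
  rewrite big_mkcond big_nat_cond [leRHS]big_nat_cond; apply: ler_sum => l /andP[lx _].
  case: ifP => // _; have /andP[h0 h1] := lnT l lx.
  apply: (le_trans (y := \sum_(1 <= l' < x.+1 | prime l') T%:R * (T%:R * (l%:R - 1 == l'%:R - 1 :> F)%:R))).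
    rewrite big_nat_cond [leRHS]big_nat_cond; apply: ler_sum => l' /andP[lx' _].
    have /andP[h0' h1'] := lnT l' lx'.
    by rewrite mulrA; rewrite !ler_pM ?mulr_ge0 ?ler0n.
  by rewrite -mulr_sumr -mulr_sumr !ler_wpM2l ?ler0n.
have nq : n%:R <= q%:R :> R by rewrite ler_nat /n card_Fp // leq_pred.
have qxq : q%:R * (x %/ q).+1%:R <= 2 * x%:R :> R.
  rewrite -!natrM ler_nat mulnS mulnC; have := leq_divM x q; lia.
apply: (le_trans (y := q%:R * (x%:R * (T%:R * (T%:R * (x %/ q).+1%:R))))).
  by rewrite ler_wpM2r // !mulr_ge0 ?ler0n.
have -> : q%:R * (x%:R * (T%:R * (T%:R * (x %/ q).+1%:R))) =
   (x%:R * T%:R ^+ 2) * (q%:R * (x %/ q).+1%:R) :> R by ring.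
have -> : 2 * x%:R ^+ 2 * T%:R ^+ 2 = (x%:R * T%:R ^+ 2) * (2 * x%:R) :> R by ring.
by rewrite ler_wpM2l // mulr_ge0 ?sqr_ge0 ?ler0n.
Qed.

End Counting.

(** * Choice of parameters *)

Section Arith.
Variable R : realFieldType.

(** If [t] exceeds [h] then [t / h >= 1] is at most its own power.  This trades
    the distinction between good characters ([t <= h]) and bad ones for a
    single sum: the first term is absorbed by a mean square and the second by a
    moment. *)
Lemma le_threshold_power (k : nat) (h t : R) : (0 < k)%N -> 0 < h -> 0 <= t ->
  t <= h + h / h ^+ (k + k) * t ^+ (k + k).
Proof.
move=> k0 h0 t0; have hk : 0 <= h / h ^+ (k + k) by rewrite divr_ge0 ?exprn_ge0 ?ltW.
have [th|ht] := leP t h.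
  by rewrite -[leLHS]addr0 lerD // mulr_ge0 // exprn_ge0.
have r1 : 1 <= t / h by rewrite ler_pdivlMr // mul1r ltW.
have e : h / h ^+ (k + k) * t ^+ (k + k) = h * (t / h) ^+ (k + k).
  by rewrite expr_div_n mulrAC mulrA.
rewrite e -[leLHS]add0r lerD ?(ltW h0) // -[leLHS](divfK (lt0r_neq0 h0)) mulrC.
by rewrite ler_wpM2l ?(ltW h0) // ler_eXnr // addn_gt0 k0.
Qed.

Lemma sqr_parameter (a b : R) (k : nat) :
  (a ^+ (9 + 13 * k) * b ^+ (5 + 5 * k)) ^+ 2 = a ^+ 18 * b ^+ 10 * (a ^+ 26 * b ^+ 10) ^+ k.
Proof.
have e1 : ((9 + 13 * k) * 2 = 18 + 26 * k)%N by lia.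
have e2 : ((5 + 5 * k) * 2 = 10 + 10 * k)%N by lia.
by rewrite [LHS]exprMn -(exprM a) -(exprM b) e1 e2 (exprD a) (exprD b) (exprM a) (exprM b) mulrACA -exprMn.
Qed.

(** The exponents in the definition of [u] are chosen here: with
    [n <= (8 T P) ^ k], the left-hand side is at most
    [h * M ^ 2 * (2 ^ 25 * T ^ 10) ^ k], where the two powers of [2 ^ 11 T ^ 4]
    come from the threshold [h].  The saving [u ^ 2] hidden in [M ^ 2] has to
    absorb the last factor. *)
Lemma bad_char_arith (k : nat) (q n z P T x u M h : R) :
  0 < q -> n <= q -> 0 < z -> 0 < P -> q <= (2 * z) ^+ k -> 1 <= T ->
  x = q * u ^+ 6 -> u = 2 ^+ (9 + 13 * k) * T ^+ (5 + 5 * k) ->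
  M = 16 * (q * u ^+ 5 * T ^+ 4) -> z <= 4 * T * P -> h = P / (2 ^+ 11 * T ^+ 4) ->
  h / h ^+ (k + k) * (M ^+ 2 * (n * P ^+ k * T ^+ k)) <= h * x ^+ 2.
Proof.
move=> q0 nq z0 P0 qz T1 xE uE ME hP hE.
have T0 : 0 < T := lt_le_trans ltr01 T1; have t0 := ltW T0.
have two1 : 1 <= 2 :> R by rewrite ler1n.
have two0 : 0 <= 2 :> R by rewrite ler0n.
have T40 : 0 < 2 ^+ 11 * T ^+ 4 := mulr_gt0 (exprn_gt0 11 (ltr0Sn _ 1)) (exprn_gt0 4 T0).
have h0 : 0 < h by rewrite hE divr_gt0.
have Pk0 : 0 < P ^+ k by rewrite exprn_gt0.
have nP : n <= (8 * T) ^+ k * P ^+ k.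
  apply: (le_trans nq); apply: (le_trans qz); rewrite -exprMn.
  apply: lerXn2r; rewrite ?nnegrE; [by rewrite mulr_ge0 // ltW|by rewrite !mulr_ge0 // ltW|].
  have -> : 8 * T * P = 2 * (4 * T * P) by ring.
  by rewrite ler_wpM2l.
have -> : h / h ^+ (k + k) * (M ^+ 2 * (n * P ^+ k * T ^+ k)) =
  h * (M ^+ 2 * (n * P ^+ k * T ^+ k) / h ^+ (k + k)) by ring.
rewrite ler_wpM2l ?(ltW h0) // ler_pdivrMr ?exprn_gt0 //.
have hk : h ^+ (k + k) * (2 ^+ 11 * T ^+ 4) ^+ (k + k) = P ^+ (k + k).
  by rewrite -exprMn hE divfK ?(lt0r_neq0 T40).
rewrite -(ler_pM2r (exprn_gt0 (k + k) T40)) -[leRHS]mulrA hk.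
apply: (le_trans (y := M ^+ 2 * ((8 * T) ^+ k * P ^+ k * P ^+ k * T ^+ k) * (2 ^+ 11 * T ^+ 4) ^+ (k + k))).
  rewrite ler_wpM2r ?exprn_ge0 ?(ltW T40) // ler_wpM2l ?sqr_ge0 //.
  by rewrite ler_wpM2r ?exprn_ge0 // ler_wpM2r ?(ltW Pk0).
have -> : M ^+ 2 * ((8 * T) ^+ k * P ^+ k * P ^+ k * T ^+ k) * (2 ^+ 11 * T ^+ 4) ^+ (k + k) =
   M ^+ 2 * ((2 : R) ^+ 25 * T ^+ 10) ^+ k * P ^+ (k + k).
  have -> : (2 ^+ 11 * T ^+ 4) ^+ (k + k) = ((2 ^+ 11 * T ^+ 4) ^+ 2) ^+ k by rewrite -exprM mul2n addnn.
  have -> : (2 : R) ^+ 25 * T ^+ 10 = 8 * T * T * (2 ^+ 11 * T ^+ 4) ^+ 2 by ring.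
  rewrite [(8 * T * T * _) ^+ k]exprMn [(8 * T * T) ^+ k]exprMn exprD.
  set a := (8 * T) ^+ k; set b := (_ ^+ 2) ^+ k; ring.
rewrite ler_wpM2r ?exprn_ge0 ?(ltW P0) //.
have u2 : u ^+ 2 = 2 ^+ 18 * T ^+ 10 * ((2 : R) ^+ 26 * T ^+ 10) ^+ k.
  by rewrite uE sqr_parameter.
have le1 : ((2 : R) ^+ 25 * T ^+ 10) ^+ k * (256 * T ^+ 8) <= u ^+ 2.
  have c0 i : 0 <= (2 : R) ^+ i * T ^+ 10 by rewrite mulr_ge0 ?exprn_ge0.
  have c1 : ((2 : R) ^+ 25 * T ^+ 10) ^+ k <= ((2 : R) ^+ 26 * T ^+ 10) ^+ k.
    by rewrite lerXn2r ?nnegrE // ler_wpM2r ?exprn_ge0 // ler_weXn2l.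
  have c2 : 256 * T ^+ 8 <= (2 : R) ^+ 18 * T ^+ 10.
    have -> : 256 = 2 ^+ 8 :> R by ring.
    by rewrite ler_pM ?exprn_ge0 // ler_weXn2l.
  rewrite u2 [leRHS]mulrC; apply: ler_pM c1 c2; first by rewrite exprn_ge0.
  exact: (mulr_ge0 (ler0n _ 256) (exprn_ge0 8 t0)).
have -> : M ^+ 2 * ((2 : R) ^+ 25 * T ^+ 10) ^+ k =
   (q * u ^+ 5) ^+ 2 * (((2 : R) ^+ 25 * T ^+ 10) ^+ k * (256 * T ^+ 8)) by rewrite ME; ring.
have -> : x ^+ 2 = (q * u ^+ 5) ^+ 2 * u ^+ 2 by rewrite xE; ring.
by rewrite ler_wpM2l ?sqr_ge0.
Qed.

Lemma parameter_ge (k : nat) (T : R) : 1 <= T ->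
  512 * T ^+ 4 <= 2 ^+ (9 + 13 * k) * T ^+ (5 + 5 * k).
Proof.
move=> T1; have two1 : 1 <= 2 :> R by rewrite ler1n.
have t0 : 0 <= T := le_trans ler01 T1.
have -> : 512 = 2 ^+ 9 :> R by ring.
apply: ler_pM; rewrite ?exprn_ge0 //.
  by rewrite ler_weXn2l // leq_addr.
by rewrite ler_weXn2l // -addSn leq_addr.
Qed.

Lemma length_arith (q T u : R) : 0 < q -> 1 <= T -> 512 * T ^+ 4 <= u ->
  3 * 512 * q * T ^+ 4 < q * u ^+ 6.
Proof.
move=> q0 T1 uT; have T4 : 1 <= T ^+ 4 by rewrite exprn_ege1.
have u1 : 512 <= u by lra.
have u5 : u <= u ^+ 5 by apply: ler_eXnr => //; lra.
have e : 3 * 512 * q * T ^+ 4 = q * (3 * (512 * T ^+ 4)) by ring.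
rewrite e ltr_pM2l // exprS.
apply: (lt_le_trans (y := u * 512)); first by lra.
by rewrite ler_wpM2l; lra.
Qed.

Lemma combine_arith (B y t Q A H : R) : 0 < t -> 0 < y -> y <= 256 * (B * t) ->
  2 ^+ 10 * (H * t) <= y -> 2 ^+ 11 * (A * t) <= y -> 512 * (Q * t) < y -> Q < B - (H + A).
Proof. by move=> t0 y0 k1 k2 k3 k4; rewrite -(ltr_pM2r t0); lra. Qed.

(** On the right, the main term is at least [x ^ 2 P / (256 T ^ 2)], and the
    two error terms are at most [1 / 4] and [1 / 8] of this; the left-hand
    side is small because [x / q = u ^ 6] exceeds [1536 T ^ 4]. *)
Lemma count_arith (k : nat) (q n z P S0 T x u M h : R) :
  0 < q -> 0 <= n -> n <= q -> 0 < z -> q <= (2 * z) ^+ k -> 1 <= T ->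
  x = q * u ^+ 6 -> u = 2 ^+ (9 + 13 * k) * T ^+ (5 + 5 * k) ->
  M = 16 * (q * u ^+ 5 * T ^+ 4) ->
  x <= 16 * T * S0 -> z <= 4 * T * P -> h = P / (2 ^+ 11 * T ^+ 4) ->
  q * (3 * x * T ^+ 2 * P) <
  S0 ^+ 2 * P - (h * (2 * x ^+ 2 * T ^+ 2) + h / h ^+ (k + k) * (M ^+ 2 * (n * P ^+ k * T ^+ k))).
Proof.
move=> q0 n0 nq z0 qz T1 xE uE ME hS hP hE.
have T0 : 0 < T := lt_le_trans ltr01 T1.
have P0 : 0 < P by have := lt_le_trans z0 hP; rewrite pmulr_rgt0 // mulr_gt0.
have E2 := bad_char_arith q0 nq z0 P0 qz T1 xE uE ME hP hE.
have xT : 3 * 512 * q * T ^+ 4 < x.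
  by rewrite xE length_arith // uE parameter_ge.
have T40 : 0 < 2 ^+ 11 * T ^+ 4 := mulr_gt0 (exprn_gt0 11 (ltr0Sn _ 1)) (exprn_gt0 4 T0).
have h0 : 0 < h by rewrite hE divr_gt0.
have hP' : h * (2 ^+ 11 * T ^+ 4) = P by rewrite hE divfK ?(lt0r_neq0 T40).
have x0 : 0 < x.
  by rewrite xE mulr_gt0 // exprn_gt0 // uE mulr_gt0 ?exprn_gt0.
have T20 : 0 < T ^+ 2 by rewrite exprn_gt0.
have x20 : 0 < x ^+ 2 by rewrite exprn_gt0.
apply: (@combine_arith _ (x ^+ 2 * P) (T ^+ 2)) => //.
- by rewrite mulr_gt0.
- have -> : 256 * (S0 ^+ 2 * P * T ^+ 2) = (16 * T * S0) ^+ 2 * P by ring.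
  rewrite ler_wpM2r ?(ltW P0) // lerXn2r ?nnegrE ?(ltW x0) //.
  exact: le_trans (ltW x0) hS.
- have -> : 2 ^+ 10 * (h * (2 * x ^+ 2 * T ^+ 2) * T ^+ 2) = x ^+ 2 * (h * (2 ^+ 11 * T ^+ 4)) by ring.
  by rewrite hP'.
- apply: (le_trans (y := 2 ^+ 11 * (h * x ^+ 2 * T ^+ 4))).
    rewrite ler_wpM2l ?ler0n //; apply: ler_pM; rewrite ?(ltW T20) //.
      by rewrite mulr_ge0 ?divr_ge0 ?exprn_ge0 ?(ltW h0) // mulr_ge0 ?sqr_ge0 // !mulr_ge0 ?exprn_ge0 ?(ltW P0) ?(ltW T0).
    by rewrite ler_weXn2l.
  have -> : 2 ^+ 11 * (h * x ^+ 2 * T ^+ 4) = x ^+ 2 * (h * (2 ^+ 11 * T ^+ 4)) by ring.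
  by rewrite hP'.
have -> : 512 * (q * (3 * x * T ^+ 2 * P) * T ^+ 2) = (3 * 512 * q * T ^+ 4) * (x * P) by ring.
have -> : x ^+ 2 * P = x * (x * P) by ring.
by rewrite ltr_pM2r // mulr_gt0.
Qed.

End Arith.

(** * Counting triples of primes *)

Lemma prime_count_lower (z T : nat) : (2 <= z)%N -> (z <= 2 ^ T)%N ->
  (z <= 4 * (T * \sum_(1 <= p < z.+1 | prime p) 1))%N.
Proof.
move=> z2 zT; set m := z./2.
have m0 : (0 < m)%N by rewrite half_gt0.
have mz : (m.*2 <= z)%N by rewrite -[X in (_ <= X)%N](odd_double_half z) leq_addl.
have zm : (z <= m.*2.+1)%N by rewrite -[X in (X <= _)%N](odd_double_half z) -add1n leq_add2r; case: odd.
have h := primes_lower m0 (leq_trans mz zT).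
have le : (\sum_(0 <= p < m.*2.+1 | prime p) 1 <= \sum_(1 <= p < z.+1 | prime p) 1)%N.
  rewrite big_ltn_cond //= [X in (_ <= X)%N](big_cat_nat (n := m.*2.+1)) ?leq_addr //=.
have := leq_mul (leqnn T) le; lia.
Qed.

Section Triples.
Variable R : realType.
Local Notation C := R[i].
Local Notation N := (@Normc.normc R).
Variables (q k z T : nat).
Let u := (2 ^ (9 + 13 * k) * T ^ (5 + 5 * k))%N.
Let x := (q * u ^ 6)%N.
Hypotheses (qp : prime q) (k0 : (0 < k)%N) (T1 : (0 < T)%N) (z2 : (2 <= z)%N) (zq : (z ^ k < q)%N)
  (qz : (q <= (2 * z) ^ k)%N) (uq : (u ^ 2 < q)%N) (Tq : (32 * T ^ 2 <= q)%N)
  (xT : (8 * x <= 2 ^ T)%N) (tauT : forall n, (0 < n <= x)%N -> (tau n <= T)%N).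
Local Notation F := 'F_q.

Let q0 : (0 < q)%N. Proof. exact: prime_gt0. Qed.
Let u0 : (0 < u)%N.
Proof. by rewrite muln_gt0 !expn_gt0 T1. Qed.
Let qx : (q <= x)%N. Proof. by rewrite leq_pmulr // expn_gt0 u0. Qed.
Let x2 : (x < 2 ^ T)%N. Proof. by apply: leq_trans xT; have := leq_trans q0 qx; lia. Qed.
Let zltq : (z < q)%N.
Proof. by apply: leq_ltn_trans zq; rewrite -[X in (X <= _)%N]expn1 leq_pexp2l // ltnW. Qed.

Let lnw (l : nat) : R := ln l%:R.
Let P : R := \sum_(1 <= p < z.+1 | prime p) 1.
Let S0 : R := \sum_(1 <= l < x.+1 | prime l) lnw l * (l%:R - 1 != 0 :> F)%:R.

Let lnwT l : (0 < l < x.+1)%N -> 0 <= lnw l <= T%:R.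
Proof.
move=> /andP[l0 lx]; rewrite /lnw ln_ge0 ?ler1n //= ln_nat_le //.
by apply: ltnW; apply: leq_ltn_trans x2.
Qed.

Lemma ln2_ge : 1 / 2 <= ln 2 :> R.
Proof.
have h : ln (1 + - (1 / 2) : R) <= - (1 / 2) by apply: le_ln1Dx; lra.
have -> : ln 2 = - ln (1 + - (1 / 2)) :> R.
  by rewrite -lnV ?posrE; [congr ln; field|lra].
lra.
Qed.

Let P_ge : z%:R <= 4 * T%:R * P.
Proof.
have h := prime_count_lower z2 (leq_trans (ltnW zltq) (leq_trans qx (ltnW x2))).
have -> : P = (\sum_(1 <= p < z.+1 | prime p) 1)%:R by rewrite natr_sum.
by rewrite -!natrM ler_nat -mulnA.
Qed.

(** The condition [l <> 1] modulo [q] removes at most [x / q + 1] terms, each of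
    weight at most [T]; they are negligible because [q >= 32 T ^ 2]. *)
Let S0_ge : x%:R <= 16 * T%:R * S0.
Proof.
have x2' : (2 <= x)%N by apply: leq_trans qx; apply: prime_gt1.
have h := prime_count_lower x2' (ltnW x2).
set c := (\sum_(1 <= p < x.+1 | prime p) 1)%N in h.
pose E : R := \sum_(1 <= l < x.+1) (1 == l%:R :> F)%:R.
have E_le : E <= (x %/ q).+1%:R.
  apply: le_trans (@sum_residues_le R q (fun y => (1 == y)%:R) 1 x qp (fun y => ler0n _ _)) _.
  suff -> : \sum_(y : F) (1 == y)%:R = 1 :> R by rewrite mulr1.
  rewrite (bigD1 (1 : F)) // eqxx big1 /= ?addr0 // => y ny.
  by rewrite eq_sym (negbTE ny).
have S0_lb : c%:R / 2 - T%:R * E <= S0.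
  rewrite lerBlDr /c natr_sum mulr_suml /S0 /E mulr_sumr.
  apply: (le_trans (y := \sum_(1 <= l < x.+1 | prime l) (lnw l * (l%:R - 1 != 0 :> F)%:R + T%:R * (1 == l%:R :> F)%:R))).
    rewrite big_nat_cond [leRHS]big_nat_cond; apply: ler_sum => l /andP[lx lp].
    have /andP[_ lT] := lnwT lx.
    have l2 : 1 / 2 <= lnw l.
      apply: (le_trans ln2_ge); rewrite /lnw ler_ln ?posrE ?ltr0n ?prime_gt0 // ler_nat prime_gt1 //.
    rewrite subr_eq0 eq_sym; case: eqVneq => _; rewrite !(mulr0, mulr1, addr0, add0r) //.
    exact: le_trans l2 lT.
  rewrite big_split /= lerD2l big_mkcond; apply: ler_sum => l _.
  by case: ifP => _ //; exact: mulr_ge0 (ler0n _ _) (ler0n _ _).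
have tq : T%:R * E * (16 * T%:R) <= x%:R.
  have hq : q%:R * (x %/ q).+1%:R <= 2 * x%:R :> R.
    rewrite -!natrM ler_nat mulnS mulnC; have := leq_divM x q; have := qx; lia.
  have h32 : 32 * T%:R ^+ 2 <= q%:R :> R by rewrite -natrX -natrM ler_nat.
  have h1 : 32 * T%:R ^+ 2 * E <= q%:R * (x %/ q).+1%:R.
    apply: ler_pM (mulr_ge0 (ler0n _ 32) (sqr_ge0 _)) _ h32 E_le.
    by apply: sumr_ge0 => l _; exact: ler0n.
  have -> : T%:R * E * (16 * T%:R) = (32 * T%:R ^+ 2 * E) / 2 by field.
  rewrite ler_pdivrMr //; lra.
have hR : x%:R <= 4 * (T%:R * c%:R) :> R by rewrite -!natrM ler_nat.
have T0 : 0 <= 16 * T%:R :> R by rewrite mulr_ge0.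
have := ler_wpM2l T0 S0_lb; lra.
Qed.

Let W (a : F) : R := \sum_(1 <= l < x.+1 | prime l) \sum_(1 <= l' < x.+1 | prime l')
   \sum_(1 <= p < z.+1 | prime p)
     lnw l * lnw l' * ((l%:R - 1) * (l'%:R - 1) * (p%:R - 1) == a)%:R.

(** The count is expanded over the characters.  The principal one gives
    [S0 ^ 2 * P]; the others are bounded by applying [le_threshold_power] to
    [t], then the mean square of [S] to its first term, and the pointwise bound
    of [S] with the moment of [t] to its second.  That the outcome exceeds the
    weight of the degenerate triples in [good_triple] is [count_arith]. *)
Lemma weighted_triples_lower (a : F) : a != 0 ->
  3 * x%:R * T%:R ^+ 2 * P < W a.
Proof.
move=> a0; have [X [XP Xsum X0 Xorth]] := characters_exist R F.
set n := #|F|.-1 in X XP Xsum X0 Xorth.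
have n0 : (0 < n)%N by apply: card_pred_gt0.
have nq : (n <= q)%N by rewrite /n card_Fp // leq_pred.
pose j0 := Ordinal n0.
pose S j : C := \sum_(1 <= l < x.+1 | prime l) (lnw l)%:C%C * X j (l%:R - 1).
pose t j : C := \sum_(1 <= p < z.+1 | prime p) X j (p%:R - 1).
have id1 : ((n%:R * W a)%:C)%C = \sum_j S j * S j * t j * conjc (X j a).
  rewrite rmorphM rmorph_nat rmorph_sum mulr_sumr /=.
  transitivity (\sum_j \sum_(1 <= l < x.+1 | prime l) \sum_(1 <= l' < x.+1 | prime l')
     \sum_(1 <= p < z.+1 | prime p) ((lnw l * lnw l')%:C)%C *
       (X j ((l%:R - 1) * (l'%:R - 1) * (p%:R - 1)) * conjc (X j a))); last first.
    apply: eq_bigr => j _; rewrite [in RHS]/S !mulr_suml; apply: eq_bigr => l _.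
    rewrite mulr_sumr !mulr_suml; apply: eq_bigr => l' _.
    rewrite [in RHS]/t mulr_sumr mulr_suml; apply: eq_bigr => p _.
    rewrite !(mult_char_mul (XP j)) rmorphM /=; ring.
  rewrite [RHS]exchange_big /=; apply: eq_bigr => l _.
  rewrite [RHS]exchange_big rmorph_sum mulr_sumr /=; apply: eq_bigr => l' _.
  rewrite [RHS]exchange_big rmorph_sum mulr_sumr /=; apply: eq_bigr => p _.
  rewrite -mulr_sumr (character_orthogonality XP Xorth) // [in LHS]rmorphM rmorph_nat /=.
  by rewrite mulrCA.
have id0 : N (S j0 * S j0 * t j0 * conjc (X j0 a)) = S0 ^+ 2 * P.
  have -> : S j0 = (S0%:C)%C.
    rewrite /S /S0 rmorph_sum /=; apply: eq_bigr => l _; rewrite rmorphM rmorph_nat /=.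
    congr (_ * _); have [->|h] := eqVneq; first by rewrite (mult_char_zero (XP j0)).
    by rewrite X0.
  have -> : t j0 = (P%:C)%C.
    rewrite /t /P rmorph_sum /= big_nat_cond [RHS]big_nat_cond; apply: eq_bigr => p /andP[/andP[_ pz] pp].
    rewrite rmorph1 X0 // pred_natr // Fp_nat_eq0 // gtnNdvd //.
      by have := prime_gt1 pp; lia.
    by rewrite ltnS in pz; have := leq_ltn_trans pz zltq; lia.
  have SS : 0 <= S0.
    have : 0 <= 16 * T%:R * S0 by apply: le_trans S0_ge; apply: ler0n.
    by rewrite pmulr_rge0 // mulr_gt0 // ltr0n.
  have PP : 0 <= P by apply: sumr_ge0.
  rewrite !Normc.normcM cnorm_conj X0 // Normc.normc1 mulr1 !cnormR.
  by rewrite !ger0_norm.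
pose M : R := 16 * (q%:R * u%:R ^+ 5 * T%:R ^+ 4).
have SM j : j != j0 -> N (S j) <= M.
  move=> jj; apply: (prime_char_sum qp (XP j) (Xsum j _) u0 uq xT tauT).
  by apply: contra jj => /eqP e; apply/eqP; apply: val_inj.
have mean : \sum_j N (S j) ^+ 2 <= 2 * x%:R ^+ 2 * T%:R ^+ 2.
  exact: (large_prime_mean_square qp XP Xorth qx x2).
have mom : \sum_j N (t j) ^+ (k + k) <= n%:R * P ^+ k * T%:R ^+ k.
  apply: (small_prime_moment qp XP Xorth zq) => m /andP[m0 mq]; apply: tauT; rewrite m0 /=.
  exact: leq_trans (ltnW mq) qx.
pose h : R := P / (2 ^+ 11 * T%:R ^+ 4).
have z0R : 0 < z%:R :> R by rewrite ltr0n ltnW.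
have T0R : 0 < T%:R :> R by rewrite ltr0n.
have P0 : 0 < P by have := lt_le_trans z0R P_ge; rewrite pmulr_rgt0 // mulr_gt0.
have h0 : 0 < h by rewrite divr_gt0 // mulr_gt0 // exprn_gt0.
have err : \sum_(j | j != j0) N (S j * S j * t j * conjc (X j a)) <=
   h * (2 * x%:R ^+ 2 * T%:R ^+ 2) + h / h ^+ (k + k) * (M ^+ 2 * (n%:R * P ^+ k * T%:R ^+ k)).
  set g := h / h ^+ (k + k).
  have g0 : 0 <= g by rewrite divr_ge0 ?exprn_ge0 // ltW.
  apply: (le_trans (y := \sum_(j | j != j0) (h * N (S j) ^+ 2 + g * (M ^+ 2 * N (t j) ^+ (k + k))))).
    apply: ler_sum => j jj; rewrite !Normc.normcM cnorm_conj (mult_char_norm (XP j)) // mulr1.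
    have t0 := cnorm_ge0 (t j); have s0 := cnorm_ge0 (S j).
    apply: (le_trans (ler_wpM2l (mulr_ge0 s0 s0) (le_threshold_power k0 h0 t0))).
    rewrite -expr2 mulrDr [h * _]mulrC lerD2l -/g mulrCA ler_wpM2l // ler_wpM2r ?exprn_ge0 //.
    by rewrite lerXn2r ?nnegrE // ?SM // (le_trans s0) ?SM.
  rewrite big_split /= -!mulr_sumr; apply: lerD.
    rewrite ler_wpM2l ?(ltW h0) //; apply: le_trans mean.
    by rewrite [leRHS](bigD1 j0) //= lerDr sqr_ge0.
  rewrite ler_wpM2l // ler_wpM2l ?sqr_ge0 //; apply: le_trans mom.
  by rewrite [leRHS](bigD1 j0) //= lerDr exprn_ge0 ?cnorm_ge0.
have lower : S0 ^+ 2 * P - \sum_(j | j != j0) N (S j * S j * t j * conjc (X j a)) <= n%:R * W a.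
  have W0 : 0 <= n%:R * W a.
    rewrite mulr_ge0 ?ler0n // /W; rewrite big_nat_cond sumr_ge0 // => l /andP[lx _].
    rewrite big_nat_cond sumr_ge0 // => l' /andP[lx' _]; rewrite sumr_ge0 // => p _.
    have /andP[? _] := lnwT lx; have /andP[? _] := lnwT lx'.
    by rewrite !mulr_ge0 ?ler0n.
  rewrite lerBlDr -[X in _ <= X + _](ger0_norm W0) -cnormR id1 (bigD1 j0) //= -id0.
  set A := _ * conjc (X j0 a); set B := \sum_(j | _) _.
  have -> : A = (A + B) - B by rewrite addrK.
  apply: le_trans (cnormB _ _) _; rewrite addrK lerD2l.
  exact: cnorm_sum.
have ar := @count_arith R k q%:R n%:R z%:R P S0 T%:R x%:R u%:R M h.
have {}ar : q%:R * (3 * x%:R * T%:R ^+ 2 * P) < n%:R * W a.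
  apply: lt_le_trans lower; apply: (lt_le_trans (ar _ _ _ _ _ _ _ _ _ _ _ _)) => //.
  - by rewrite ltr0n.
  - by rewrite ler_nat.
  - by rewrite -natrM -natrX ler_nat.
  - by rewrite ler1n.
  - by rewrite /x natrM natrX.
  - by rewrite /u natrM !natrX.
  - by rewrite lerD2l lerN2.
have W0 : 0 <= W a.
  have : 0 < n%:R * W a.
    by apply: le_lt_trans ar; rewrite !mulr_ge0 ?ler0n // ltW.
  by rewrite pmulr_rgt0 ?ltr0n // => /ltW.
have le2 : n%:R * W a <= q%:R * W a by rewrite ler_wpM2r // ler_nat.
by have := lt_le_trans ar le2; rewrite ltr_pM2l // ltr0n.
Qed.

(** Triples with a repeated prime have weight at most [3 x T ^ 2 P] altogether,
    even when the congruence is ignored, so that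
    [weighted_triples_lower] leaves a triple of distinct primes. *)
Lemma good_triple (a : F) : a != 0 -> exists l l' p,
  [/\ [/\ prime l, prime l' & prime p], [/\ (l <= x)%N, (l' <= x)%N & (p <= z)%N],
      [/\ l != l', l != p & l' != p] & (l.-1 * l'.-1 * p.-1)%:R = a].
Proof.
move=> a0; have := weighted_triples_lower a0; rewrite ltNge; apply: contraNP => none.
pose b (m m' : nat) : R := (m == m')%:R.
have b0 m m' : 0 <= b m m' by apply: ler0n.
pose pi (y : nat) : R := \sum_(1 <= l < y.+1 | prime l) 1.
have pi_le y : pi y <= y%:R.
  rewrite /pi big_mkcond; apply: (le_trans (y := \sum_(1 <= p < y.+1) 1)).
    by apply: ler_sum => p _; case: ifP.
  by rewrite big_const_nat subn1 iter_addr_0.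
have pi0 y : 0 <= pi y by apply: sumr_ge0.
have delta m y : \sum_(1 <= l < y.+1 | prime l) b l m <= 1.
  rewrite big_mkcond; apply: (le_trans (y := \sum_(1 <= l < y.+1 | l == m) 1)).
    rewrite [leRHS]big_mkcond; apply: ler_sum => l _.
    by rewrite /b; case: eqP; case: ifP.
  by rewrite big_nat1_eq; case: ifP.
have sum1 m y : \sum_(1 <= l < y.+1 | prime l) m = pi y * m.
  by rewrite /pi mulr_suml; apply: eq_bigr => l _; rewrite mul1r.
have T20 : 0 <= T%:R ^+ 2 :> R by apply: sqr_ge0.
apply: (le_trans (y := \sum_(1 <= l < x.+1 | prime l) \sum_(1 <= l' < x.+1 | prime l')
   \sum_(1 <= p < z.+1 | prime p) T%:R ^+ 2 * (b l l' + b l p + b l' p))).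
  rewrite /W big_nat_cond [leRHS]big_nat_cond; apply: ler_sum => l /andP[lx lp].
  rewrite big_nat_cond [leRHS]big_nat_cond; apply: ler_sum => l' /andP[lx' lp'].
  rewrite big_nat_cond [leRHS]big_nat_cond; apply: ler_sum => p /andP[px pp].
  have /andP[h1 h2] := lnwT lx; have /andP[h3 h4] := lnwT lx'.
  have bs : 0 <= b l l' + b l p + b l' p by rewrite !addr_ge0.
  case: eqP => [e|_]; last by rewrite mulr0 mulr_ge0.
  rewrite mulr1 expr2 -[leLHS]mulr1; apply: ler_pM; rewrite ?mulr_ge0 ?ler_pM //.
  have [e1|n1] := eqVneq l l'.
    by rewrite /b e1 eqxx -addrA lerDl addr_ge0 ?ler0n.
  have [e2|n2] := eqVneq l p.
    by rewrite /b e2 eqxx addrAC lerDr addr_ge0 ?ler0n.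
  have [e3|n3] := eqVneq l' p.
    by rewrite /b e3 eqxx lerDr addr_ge0 ?ler0n.
  exfalso; apply: none; exists l, l', p; split => //.
    by move: lx lx' px => /andP[_ ?] /andP[_ ?] /andP[_ ?]; split; rewrite -ltnS.
  by rewrite !natrM -!pred_natr.
have s1 l : \sum_(1 <= l' < x.+1 | prime l') \sum_(1 <= p < z.+1 | prime p) b l l' <= P.
  under eq_bigr do rewrite sum1; rewrite -mulr_sumr -[leRHS]mulr1 ler_wpM2l ?pi0 //.
  by under eq_bigr do rewrite /b eq_sym; apply: delta.
have s2 l : \sum_(1 <= l' < x.+1 | prime l') \sum_(1 <= p < z.+1 | prime p) b l p = pi x * \sum_(1 <= p < z.+1 | prime p) b l p.
  by rewrite sum1.
have s3 (l : nat) : \sum_(1 <= l' < x.+1 | prime l') \sum_(1 <= p < z.+1 | prime p) b l' p <= P.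
  rewrite exchange_big /=; apply: ler_sum => p _; exact: delta.
have -> : \sum_(1 <= l < x.+1 | prime l) \sum_(1 <= l' < x.+1 | prime l')
   \sum_(1 <= p < z.+1 | prime p) T%:R ^+ 2 * (b l l' + b l p + b l' p) =
  T%:R ^+ 2 * (\sum_(1 <= l < x.+1 | prime l) (
    \sum_(1 <= l' < x.+1 | prime l') \sum_(1 <= p < z.+1 | prime p) b l l' +
    \sum_(1 <= l' < x.+1 | prime l') \sum_(1 <= p < z.+1 | prime p) b l p +
    \sum_(1 <= l' < x.+1 | prime l') \sum_(1 <= p < z.+1 | prime p) b l' p)).
  rewrite mulr_sumr; apply: eq_bigr => l _; rewrite -!big_split mulr_sumr /=; apply: eq_bigr => l' _.
  by rewrite -!big_split mulr_sumr.
have -> : 3 * x%:R * T%:R ^+ 2 * P = T%:R ^+ 2 * (x%:R * P + x%:R * P + x%:R * P) by ring.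
rewrite ler_wpM2l // !big_split /=.
have PP : 0 <= P := pi0 z.
have e1 : pi x * P <= x%:R * P by rewrite ler_wpM2r.
apply: lerD; first apply: lerD.
- apply: le_trans e1; rewrite -sum1; apply: ler_sum => l _; exact: s1.
- under eq_bigr do rewrite s2.
  rewrite -mulr_sumr; apply: le_trans e1; rewrite ler_wpM2l //.
  exact: s3 0%N.
- apply: le_trans e1; rewrite -sum1; apply: ler_sum => l _; exact: s3.
Qed.

End Triples.

(** * The least preimage *)

Local Open Scope nat_scope.

(** The parameter [T] is an approximate [J]-th root of a multiple of [q ^ 2].
    Since [J > 60 + 60 k], the quantity [u ^ 6], which is a constant times
    [T ^ (30 + 30 k)], stays below [q] for large [q], so that [x <= q ^ 2] and
    [T] bounds the divisor function up to [x]. *)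
Lemma large_modulus (R : realType) (k J : nat) : 0 < k -> 60 + 60 * k < J ->
  exists C q0, forall q r, prime q -> q0 <= q -> 0 < r < q ->
    exists n u z, [/\ 0 < n, totient n = r %[mod q], n <= q ^ 2 * u ^ 12 * z, z ^ k <= q
      & (u ^ 12) ^ J <= C * q ^ (120 + 120 * k)].
Proof.
move=> k0 kJ; have J0 : 0 < J by lia.
have [J1 J2 J3 J4] : [/\ 0 < J - (60 + 60 * k), 60 + 60 * k <= J, 0 < J - 4 & 2 * 2 <= J].
  by split; lia.
have [e1 e2] : (5 + 5 * k) * 6 = 30 + 30 * k /\ 2 * (30 + 30 * k) = 60 + 60 * k by lia.
have e3 : (60 + 60 * k) * 2 = 120 + 120 * k by lia.
have [C0 C00 C0P] := tau_bound J0.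
pose C1 := 8 * J ^ J * C0; pose C2 := 2 ^ J * C1.
pose c := 2 ^ (9 + 13 * k).
pose C3 := (c ^ 6) ^ J * C2 ^ (30 + 30 * k).
have C1P : 0 < C1 by rewrite !muln_gt0 /= expn_gt0 J0 C00.
have c0 : 0 < c by rewrite expn_gt0.
exists (C3 ^ 2), (C3 + 32 ^ J * C2 ^ 2 + (2 ^ k).+1) => q r qp qbig /andP[r0 rq].
have q0 := prime_gt0 qp; have q1 := prime_gt1 qp.
have qC3 : C3 <= q := leq_trans (leq_trans (leq_addr _ _) (leq_addr _ _)) qbig.
have qC2 : 32 ^ J * C2 ^ 2 <= q := leq_trans (leq_trans (leq_addl _ _) (leq_addr _ _)) qbig.
have qk : 2 ^ k < q := leq_trans (leq_addl _ _) qbig.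
have N0 : 0 < C1 * q ^ 2 by rewrite muln_gt0 C1P expn_gt0 q0.
have [T T0 /andP[NT TN]] := approximate_root J0 N0.
have [z [z2 zq qz]] : exists z, [/\ 2 <= z, z ^ k < q & q <= (2 * z) ^ k].
  exact: root_below.
have TJ : T ^ J <= C2 * q ^ 2 by rewrite /C2 -mulnA.
pose u := 2 ^ (9 + 13 * k) * T ^ (5 + 5 * k).
have u6 : (u ^ 6) ^ J <= C3 * q ^ (60 + 60 * k).
  have -> : (u ^ 6) ^ J = (c ^ 6) ^ J * (T ^ J) ^ (30 + 30 * k).
    rewrite /u -/c (expnMn c) (expnMn (c ^ 6)) -[(T ^ _) ^ 6]expnM e1.
    by rewrite (expnAC T).
  rewrite /C3 -mulnA leq_mul2l; apply/orP; right.
  apply: (leq_trans (expn_mono _ TJ)); rewrite expnMn leq_mul2l -expnM; apply/orP; right.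
  by rewrite e2.
have u6q : u ^ 6 <= q.
  rewrite -(@leq_exp2r _ _ J) //; apply: (leq_trans u6).
  have -> : q ^ J = q ^ (J - (60 + 60 * k)) * q ^ (60 + 60 * k) by rewrite -expnD subnK.
  rewrite leq_mul2r; apply/orP; right; apply: (@leq_trans (q ^ 1)); first by rewrite expn1.
  by rewrite leq_pexp2l.
have T2q : 32 * T ^ 2 <= q.
  rewrite -(@leq_exp2r _ _ J) // expnMn -expnM mulnC [2 * J]mulnC expnM.
  apply: (@leq_trans ((C2 * q ^ 2) ^ 2 * 32 ^ J)); first by rewrite leq_mul2r expn_mono ?orbT.
  rewrite expnMn -expnM.
  have -> : q ^ J = q ^ (J - 4) * q ^ (2 * 2) by rewrite -expnD subnK.
  rewrite mulnAC leq_mul2r; apply/orP; right; apply: (@leq_trans (q ^ 1)).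
    by rewrite expn1 mulnC.
  by rewrite leq_pexp2l.
have c2 : 2 <= c by rewrite -[X in X <= _]expn1 leq_pexp2l.
have u2 : 2 <= u by apply: leq_trans c2 _; rewrite leq_pmulr // expn_gt0 T0.
have uq : u ^ 2 < q by apply: leq_trans u6q; rewrite ltn_exp2l.
pose x := q * u ^ 6.
have xq : x <= q ^ 2 by rewrite /x -mulnn leq_mul2l u6q orbT.
have xT : 8 * x <= 2 ^ T.
  have h := succ_exp_le T J0; have JJ0 : 0 < J ^ J by rewrite expn_gt0 J0.
  rewrite -(leq_pmul2l JJ0); apply: leq_trans h.
  apply: (@leq_trans (T ^ J)); last by apply: expn_mono.
  apply: leq_trans NT; rewrite /C1 mulnCA mulnA -!mulnA leq_mul2l leq_mul2l; apply/orP; right; apply/orP; right.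
  by apply: leq_trans xq _; rewrite leq_pmull.
have tauT n : 0 < n <= x -> tau n <= T.
  move=> /andP[n0 nx]; rewrite -(@leq_exp2r _ _ J) //; apply: (leq_trans (C0P n n0)).
  apply: leq_trans NT; rewrite /C1 -mulnA.
  apply: (@leq_trans (C0 * q ^ 2)); first by rewrite leq_mul2l (leq_trans nx xq) orbT.
  by rewrite leq_pmull // !muln_gt0 /= expn_gt0 J0.
have ra : (r%:R != 0 :> 'F_q)%R by rewrite Fp_nat_eq0 // gtnNdvd.
have [l [l' [p [[pl pl' pp] [lx lx' pz] [n1 n2 n3] e]]]] :=
  good_triple R qp k0 T0 z2 zq qz uq T2q xT tauT ra.
exists (l * l' * p), u, z; split.
- by rewrite !muln_gt0 !prime_gt0.
- rewrite totient_three_primes //; move: e => /(congr1 val); rewrite /= !val_Fp_nat //.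
- apply: (@leq_trans (x * x * z)); first by rewrite !leq_mul.
  rewrite leq_mul2r; apply/orP; right; rewrite /x.
  by rewrite mulnACA mulnn -expnD.
- exact: ltnW.
have -> : (u ^ 12) ^ J = ((u ^ 6) ^ J) ^ 2 by rewrite [RHS]expnAC -(expnM u 6 2).
apply: (leq_trans (expn_mono 2 u6)); rewrite expnMn leq_mul2l -expnM.
by rewrite e3 leqnn orbT.
Qed.

Local Open Scope ring_scope.

Lemma root_le_powR (R : realType) (a q e E : R) (J m : nat) :
  0 <= a -> 1 <= q -> 1 <= E -> (0 < J)%N -> m%:R <= J%:R * e ->
  a ^+ J <= E * q ^+ m -> a <= E * q `^ e.
Proof.
move=> a0 q1 E1 J0 me h; have q0 : 0 <= q by apply: le_trans q1.
have E0 : 0 <= E by apply: le_trans E1.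
have rhs0 : 0 <= E * q `^ e by rewrite mulr_ge0 // powR_ge0.
rewrite -(ler_pXn2r J0) ?nnegrE //; apply: (le_trans h).
rewrite exprMn; apply: ler_pM => //; first by rewrite exprn_ge0.
  by rewrite ler_eXnr.
rewrite -powR_mulrn // -powR_mulrn ?powR_ge0 // -powRrM.
by apply: ler_powR => //; rewrite mulrC.
Qed.

Lemma least_preimage (q : nat) (a : int) (n r : nat) : prime q ->
  (r = `|(a %% q)%Z|)%N -> (0 < n)%N -> totient n = r %[mod q] ->
  exists2 m, is_least_totient_preimage q a m & (m <= n)%N.
Proof.
move=> qp re n0 nr; have q0 := prime_gt0 qp.
have qz : (q%:Z != 0) by rewrite eqz_nat -lt0n.
have rZ : (r%:Z = (a %% q)%Z) by rewrite re gez0_abs // modz_ge0.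
have congr m : (Posz (totient m) = a %[mod Posz q])%Z <-> totient m = r %[mod q].
  rewrite -rZ modz_nat; have -> : (r = r %% q)%N.
    by apply/esym/modn_small; rewrite -ltz_nat rZ ltz_pmod.
  by rewrite modn_mod; split=> [[]|->].
have ex : exists m, (0 < m)%N && (totient m == r %[mod q]) by exists n; rewrite n0 nr /=.
have [m /andP[m0 /eqP mr] mmin] := ex_minnP ex.
exists m; last by apply: mmin; rewrite n0 nr /=.
split=> //; first exact/congr.
by move=> m' m'0 /congr h; apply: mmin; rewrite m'0 h /=.
Qed.

Unset Implicit Arguments.

Theorem theorem1 (R : realType) (eps : R) (heps : 0 < eps) :
  exists C : R, 0 < C /\
    forall (q : nat) (a : int), prime q ->
      exists n : nat,
        is_least_totient_preimage q a n /\ n%:R <= C * q%:R `^ (2 + eps).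
Proof.
pose k := (Num.truncn (2 / eps)).+1; pose J := (Num.truncn ((120 + 120 * k)%:R * (2 / eps)) + 61 + 60 * k)%N.
have e20 : 0 < 2 / eps by rewrite divr_gt0.
have ke : 1%:R <= k%:R * (eps / 2).
  have : 2 / eps < k%:R by rewrite -truncn_le_nat.
  rewrite ltr_pdivrMr // mulrA ler_pdivlMr // mul1r; lra.
have Je : (120 + 120 * k)%:R <= J%:R * (eps / 2).
  have h : (120 + 120 * k)%:R * (2 / eps) <= J%:R.
    apply: ltW; apply: (lt_le_trans (y := (Num.truncn ((120 + 120 * k)%:R * (2 / eps))).+1%:R)).
      by rewrite -truncn_le_nat.
    by rewrite ler_nat /J; lia.
  have -> : (120 + 120 * k)%:R = (120 + 120 * k)%:R * (2 / eps) * (eps / 2) :> R.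
    by field; rewrite lt0r_neq0.
  by rewrite ler_wpM2r // divr_ge0 // ltW.
have k0 : (0 < k)%N by [].
have kJ : (60 + 60 * k < J)%N by rewrite /J; lia.
have [C [q0 big]] := large_modulus R k0 kJ.
pose E : R := C.+1%:R; pose B : R := E + (q0`!)%:R.
have E1 : 1 <= E by rewrite ler1n.
have f0 : 0 <= (q0`!)%:R :> R by rewrite ler0n.
exists B; split; first by rewrite /B; lra.
move=> q a qp; have qpos := prime_gt0 qp.
have q1 : 1 <= q%:R :> R by rewrite ler1n.
have pow1 e : 0 <= e -> 1 <= q%:R `^ e :> R.
  by move=> e0; rewrite -[leLHS](powRr0 q%:R) ler_powR.
have qe1 : 1 <= q%:R `^ (2 + eps) by apply: pow1; rewrite addr_ge0 // ltW.
have Q0 : 0 <= q%:R `^ (2 + eps) by apply: le_trans qe1.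
have Qsplit : q%:R `^ (2 + eps) = q%:R ^+ 2 * (q%:R `^ (eps / 2) * q%:R `^ (eps / 2)).
  have qn0 : q%:R != 0 :> R by rewrite pnatr_eq0 -lt0n.
  rewrite -powR_mulrn ?ler0n // -!powRD ?qn0 ?implybT //; congr (_ `^ _).
  by field.
pose r := (`|(a %% q)%Z|)%N.
have rq : (r < q)%N.
  have qz : (q%:Z != 0) by rewrite eqz_nat -lt0n.
  by rewrite -ltz_nat /r gez0_abs ?modz_ge0 // ltz_pmod.
suff [n [n0 nr nB]] : exists n, [/\ (0 < n)%N, totient n = r %[mod q] & n%:R <= B * q%:R `^ (2 + eps)].
  have [m mP mn] := least_preimage qp (erefl r) n0 nr.
  by exists m; split=> //; apply: le_trans nB; rewrite ler_nat.
have p1 : 1 <= q%:R `^ (eps / 2) by apply: pow1; rewrite divr_ge0 // ltW.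
have [r0|r0] := posnP r.
  exists (q ^ 2)%N; split; first by rewrite expn_gt0 qpos.
    by rewrite r0 mod0n totient_pfactor //= expn1 modnMl.
  rewrite natrX Qsplit mulrCA -[leLHS]mulr1 ler_wpM2l ?sqr_ge0 //.
  have pp1 : 1 <= q%:R `^ (eps / 2) * q%:R `^ (eps / 2) by rewrite mulr_ege1.
  rewrite -[leLHS]mulr1 ler_pM // /B; lra.
have [qsmall|qlarge] := ltnP q q0.
  have [n [n0 nq nr]] := small_modulus qp (introT andP (conj r0 rq)).
  exists n; split=> //; rewrite -[leLHS]mulr1 ler_pM ?ler0n //.
  apply: (le_trans (y := (q0`!)%:R)); last by rewrite /B; lra.
  rewrite ler_nat (leq_trans nq) //; apply: dvdn_leq; first exact: fact_gt0.
  by rewrite (fact_split (ltnW qsmall)) dvdn_mulr.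
have [n [u [z [n0 nr nb zk uJ]]]] := big q r qp qlarge (introT andP (conj r0 rq)).
exists n; split=> //.
have z_le : z%:R <= 1 * q%:R `^ (eps / 2).
  by apply: (@root_le_powR R _ _ _ _ k 1) => //; rewrite mul1r expr1 -natrX ler_nat.
have u_le : (u ^ 12)%:R <= E * q%:R `^ (eps / 2).
  apply: (@root_le_powR R _ _ _ _ J (120 + 120 * k)) => //; first exact: leq_ltn_trans kJ.
  rewrite /E -!natrX -natrM ler_nat; apply: (leq_trans uJ).
  by rewrite leq_mul2r leqnSn orbT.
rewrite mul1r in z_le.
apply: (le_trans (y := (q ^ 2 * u ^ 12 * z)%:R)); first by rewrite ler_nat.
rewrite (natrM _ (q ^ 2 * u ^ 12)%N) (natrM _ (q ^ 2)%N) (natrX _ _ 2).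
apply: (le_trans (y := q%:R ^+ 2 * (E * q%:R `^ (eps / 2)) * q%:R `^ (eps / 2))).
  by rewrite !ler_pM ?mulr_ge0 ?sqr_ge0 ?ler0n.
have -> : q%:R ^+ 2 * (E * q%:R `^ (eps / 2)) * q%:R `^ (eps / 2) = E * q%:R `^ (2 + eps).
  by rewrite Qsplit; ring.
by rewrite ler_wpM2r // /B; lra.
Qed.
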